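(* Let $p=p(n)$ be such that $pn \ge n^{2/\sqrt{\log n}}$, and let $G \in G(n,p)$. Then asymptotically almost surely $$t(G) = (1+o(1))\,p\,t(K_n).$$
   Context: $G(n,p)$ is the binomial random graph on $n$ vertices in which each pair of vertices is joined independently with probability $p$. A property holds asymptotically almost surely (a.a.s.) if it holds with probability tending to $1$ as $n\to\infty$. All graphs are finite, simple and undirected. A configuration of a graph $G$ is a function $c: V(G)\to \mathbb{N}\cup\{0\}$. A vertex $v$ may be fired if $c(v)\ge \deg(v)$; firing $v$ removes $\deg(v)$ chips from $v$ and adds one chip to each neighbour of $v$. A configuration is volatile if there is an infinite sequence of vertices that may be fired in that order. The toppling game on $G$: starting with no chips, players Max and Min alternately place one chip on a vertex (Max first); the game ends once a volatile configuration is reached. Max aims to maximize and Min to minimize the number of chips placed. The toppling number $t(G)$ is the length of the game when Max starts and both play optimally. *)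

(* Defs.v *)
From mathcomp Require Import all_boot all_order all_algebra.
From mathcomp Require Import all_classical all_reals all_analysis.

Set Implicit Arguments.
Unset Strict Implicit.
Unset Printing Implicit Defensive.

Import Order.TTheory GRing.Theory Num.Theory.
Import numFieldNormedType.Exports.

Local Open Scope ring_scope.

(* Finite simple undirected graphs on the vertex set {0, ..., n-1}, given by
   their edge sets. *)
Definition sgraph (n : nat) : Type :=
  {E : {set {set 'I_n}} | [forall e in E, #|e| == 2%N]}.

Definition edges (n : nat) (G : sgraph n) : {set {set 'I_n}} := val G.

Definition adj (n : nat) (G : sgraph n) : rel 'I_n :=
  [rel u v | [set u; v] \in edges G].

Definition deg (n : nat) (G : sgraph n) (v : 'I_n) : nat :=
  #|[pred u | adj G v u]|.

Lemma complete_subproof (n : nat) :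
  [forall e in [set e : {set 'I_n} | #|e| == 2%N], #|e| == 2%N].
Proof. by apply/forall_inP => e; rewrite inE. Qed.

Definition complete_graph (n : nat) : sgraph n :=
  exist _ [set e : {set 'I_n} | #|e| == 2%N] (complete_subproof n).

Definition config (n : nat) : Type := {ffun 'I_n -> nat}.

(* Meant for [deg G v <= c v]: the subtraction on nat is truncated. *)
Definition fire (n : nat) (G : sgraph n) (v : 'I_n) (c : config n) : config n :=
  [ffun w => (if w == v then c v - deg G v else c w + adj G v w)%N].

Fixpoint fire_seq (n : nat) (G : sgraph n) (s : nat -> 'I_n) (c : config n)
    (k : nat) : config n :=
  if k is k'.+1 then fire G (s k') (fire_seq G s c k') else c.

Definition volatile (n : nat) (G : sgraph n) (c : config n) : Prop :=
  exists s : nat -> 'I_n, forall k, (deg G (s k) <= fire_seq G s c k (s k))%N.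

(* A strategy selects a vertex from the list of all earlier moves, oldest
   first. *)
Definition strategy (n : nat) : Type := seq 'I_n -> 'I_n.

Fixpoint moves (n : nat) (sMax sMin : strategy n) (k : nat) : seq 'I_n :=
  if k is k'.+1 then
    let h := moves sMax sMin k' in
    rcons h (if odd k' then sMin h else sMax h)
  else [::].

Definition position (n : nat) (sMax sMin : strategy n) (k : nat) : config n :=
  [ffun v => count_mem v (moves sMax sMin k)].

Section Termination.
Context (n : nat) (G : sgraph n).
Implicit Types (c : config n) (v : 'I_n).

Lemma adjxx v : adj G v v = false.
Proof.
apply/negP => /= h; have /forall_inP/(_ _ h) := valP G.
by rewrite finset.setUid cards1.
Qed.

Lemma sum_fire c v : (deg G v <= c v)%N ->
  (\sum_w fire G v c w = \sum_w c w)%N.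
Proof.
move=> h; rewrite (bigD1 v) //= [RHS](bigD1 v) //= ffunE eqxx.
have -> : (\sum_(w | w != v) fire G v c w =
           \sum_(w | w != v) c w + deg G v)%N.
  have -> : deg G v = (\sum_(w | w != v) adj G v w)%N.
    rewrite /deg -sum1_card big_mkcond [LHS](bigD1 v) //=.
    rewrite [X in (X + _)%N](_ : _ = 0%N); last first.
      by rewrite unfold_in -/(adj G v v) adjxx.
    by apply: eq_bigr => w _; rewrite unfold_in -/(adj G v w); case: (adj G v w).
  rewrite -big_split /=; apply: eq_bigr => w /negbTE hw.
  by rewrite ffunE hw.
by rewrite addnCA [RHS]addnC subnK.
Qed.

Lemma fireable c (v0 : 'I_n) : (\sum_v deg G v <= \sum_v c v)%N ->
  exists v, (deg G v <= c v)%N.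
Proof.
move=> h; apply/existsP; apply: contraLR h => /existsPn h.
rewrite -ltnNge (bigD1 v0) //= [X in (_ < X)%N](bigD1 v0) //=.
rewrite -addSn leq_add //; first by rewrite ltnNge h.
by apply: leq_sum => v _; apply: ltnW; rewrite ltnNge h.
Qed.

Lemma volatile_large c (v0 : 'I_n) : (\sum_v deg G v <= \sum_v c v)%N ->
  volatile G c.
Proof.
move=> h.
pose nxt c' := odflt v0 [pick v | (deg G v <= c' v)%N].
pose cs k := iter k (fun c' => fire G (nxt c') c') c.
have nxtP c' : (\sum_v deg G v <= \sum_v c' v)%N ->
    (deg G (nxt c') <= c' (nxt c'))%N.
  move=> /(fireable v0)[v hv]; rewrite /nxt.
  by case: pickP => //= /(_ v); rewrite hv.
have csP k : (\sum_v cs k v = \sum_v c v)%N.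
  elim: k => // k IH; rewrite [cs _]/= -/(cs k) sum_fire //.
  by apply: nxtP; rewrite IH.
exists (fun k => nxt (cs k)) => k.
have -> : fire_seq G (fun k => nxt (cs k)) c k = cs k.
  by elim: k => //= k ->.
by apply: nxtP; rewrite csP.
Qed.

Lemma size_moves (sMax sMin : strategy n) k : size (moves sMax sMin k) = k.
Proof. by elim: k => //= k IH; rewrite size_rcons IH. Qed.

Lemma sum_position (sMax sMin : strategy n) k :
  (\sum_v position sMax sMin k v)%N = k.
Proof.
rewrite -[RHS](size_moves sMax sMin); under eq_bigr do rewrite ffunE.
elim: (moves _ _ _) => [|x s IH] /=; first by rewrite big1.
rewrite big_split /= IH (bigD1 x) //= eqxx big1 ?addn0 ?add1n// => v.
by rewrite eq_sym => /negbTE ->.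
Qed.

Lemma volatile_position (sMax sMin : strategy n) :
  volatile G (position sMax sMin (\sum_v deg G v)).
Proof. by apply: (volatile_large (sMax [::])); rewrite sum_position. Qed.

Lemma game_ends (sMax sMin : strategy n) :
  exists k, `[< volatile G (position sMax sMin k) >].
Proof. by eexists; apply/asboolP/volatile_position. Qed.

End Termination.

Definition game_length (n : nat) (G : sgraph n) (sMax sMin : strategy n) : nat :=
  ex_minn (game_ends G sMax sMin).

Lemma game_length_le (n : nat) (G : sgraph n) (sMax sMin : strategy n) :
  (game_length G sMax sMin <= \sum_v deg G v)%N.
Proof.
rewrite /game_length; case: ex_minnP => m _; apply.
exact/asboolP/volatile_position.
Qed.

(* The lengths are natural numbers, bounded by [game_length_le], so that the
   supremum and the infimum are a maximum and a minimum when [0 < n]. *)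
Definition toppling_number (R : realType) (n : nat) (G : sgraph n) : R :=
  sup [set inf [set (game_length G sMax sMin)%:R | sMin in [set: strategy n]]
      | sMax in [set: strategy n]]%classic.

Definition gnp_weight (R : realType) (n : nat) (p : R) (G : sgraph n) : R :=
  \prod_(e : {set 'I_n} | #|e| == 2%N) (if e \in edges G then p else 1 - p).

Definition gnp_prob (R : realType) (n : nat) (p : R) (A : pred (sgraph n)) : R :=
  \sum_(G : sgraph n | A G) gnp_weight p G.

Lemma gnp_prob_setT (R : realType) (n : nat) (p : R) :
  gnp_prob p (@predT (sgraph n)) = 1.
Proof.
pose F (e : {set 'I_n}) := if #|e| == 2%N then p else 0.
pose H (e : {set 'I_n}) := if #|e| == 2%N then 1 - p else 1.
have : \prod_e (F e + H e) = 1.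
  by apply: big1 => e _; rewrite /F /H; case: ifP; rewrite ?add0r// addrC subrK.
rewrite bigA_distr => <-.
rewrite (bigID (fun J : {set {set 'I_n}} => [forall e in J, #|e| == 2%N])) /=.
rewrite [X in _ = _ + X]big1 ?addr0; last first.
  move=> J /forall_inPn[e eJ /negbTE e2].
  by rewrite (bigD1 e) //= eJ /F e2 mul0r.
rewrite /gnp_prob.
transitivity (\sum_(G : sgraph n)
    \prod_e (if e \in val G then F e else H e)).
  apply: eq_bigr => G _; rewrite /gnp_weight big_mkcond; apply: eq_bigr => e _.
  rewrite /F /H /edges; case: ifP => // e2; case: ifP => // eG.
  by have /forall_inP/(_ _ eG) := valP G; rewrite e2.
rewrite -(big_sub [pred J : {set {set 'I_n}} | [forall e in J, #|e| == 2%N]]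
  (fun J : {set {set 'I_n}} => \prod_e (if e \in J then F e else H e))).
by apply: eq_bigl => J; rewrite !inE.
Qed.

Definition aas (R : realType) (p : nat -> R) (A : forall n, pred (sgraph n)) :
    Prop :=
  (gnp_prob (p n) (A n) @[n --> \oo] --> (1 : R))%classic.

(* Main.v *)
(** A configuration is volatile iff no vector of firing numbers stabilizes it,
    so volatility of c is a statement about integer vectors u with u close to
    c / deg + P u, where P is the random walk. For c at most a constant times
    deg, such a u satisfies |u - P u| <= C; starting from a vertex of minimal
    (or maximal) value and expanding through the graph, Markov's inequality in
    each neighbourhood shows that u varies by at most O(3 ^ k), where k is
    close to log n / log (p n) <= sqrt (log n) / 2. As p n >= exp (2 sqrt (log
    n)), this is far below sqrt (p n), the accuracy of the edge counts of
    G(n, p), so that P u is almost everywhere close to the mean of u, as on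
    K_n. Hence for bounded configurations volatility on G and on K_n, scaled by
    p, agree up to eps p n chips on each vertex.

    Configurations reached in the game need not be bounded. Min therefore plays
    on one graph by imagining a game on the other in a bounded number of blocks:
    the moves of each block are replaced by their stabilization, which is at
    most deg on every vertex and equivalent by the abelian property. *)

Require Import Defs.
From mathcomp Require Import all_boot all_order all_algebra.
From mathcomp Require Import all_classical all_reals all_analysis.
From mathcomp Require Import zify ring lra.
Import Order.TTheory GRing.Theory Num.Theory.
Import numFieldNormedType.Exports.
Local Open Scope ring_scope.

Set Implicit Arguments.
Unset Strict Implicit.
Unset Printing Implicit Defensive.

Section ChipFiring.
Local Open Scope nat_scope.
Context (n : nat) (G : sgraph n).
Implicit Types (c b z : config n) (v w : 'I_n) (u x : 'I_n -> nat).

Lemma adjC v w : adj G v w = adj G w v.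
Proof. by rewrite /adj /= finset.setUC. Qed.

Lemma deg_sum v : deg G v = \sum_w adj G v w.
Proof.
rewrite /deg -sum1_card big_mkcond; apply: eq_bigr => w _.
by rewrite unfold_in -/(adj G v w); case: (adj G v w).
Qed.

Definition nbsum x v : nat := \sum_w adj G v w * x w.

Lemma leq_nbsum x u v : (forall w, x w <= u w) -> nbsum x v <= nbsum u v.
Proof. by move=> xu; apply: leq_sum => w _; rewrite leq_mul2l xu orbT. Qed.

Lemma nbsumD x u v : nbsum (fun w => x w + u w) v = nbsum x v + nbsum u v.
Proof. by rewrite -big_split; apply: eq_bigr => w _; rewrite /= mulnDr. Qed.

Lemma nbsum_cst k v : nbsum (fun=> k) v = deg G v * k.
Proof. by rewrite deg_sum big_distrl. Qed.

Lemma nbsum_dirac w v : nbsum (fun i => i == w) v = adj G w v.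
Proof.
rewrite /nbsum (bigD1 w) //= eqxx muln1 adjC big1 ?addn0// => i /negbTE ->.
by rewrite muln0.
Qed.

Lemma sum_nbsum x : \sum_v nbsum x v = \sum_v deg G v * x v.
Proof.
rewrite exchange_big; apply: eq_bigr => w _ /=; rewrite deg_sum big_distrl.
by apply: eq_bigr => v _; rewrite adjC.
Qed.

Definition stabilizes c u := forall v, c v + nbsum u v < deg G v * (u v).+1.

Definition fired (s : nat -> 'I_n) k v := \sum_(i < k) (s i == v).

Lemma firedS s k v : fired s k.+1 v = fired s k v + (v == s k).
Proof. by rewrite /fired big_ord_recr /= eq_sym. Qed.

Lemma sum_fired s k : \sum_v fired s k v = k.
Proof.
rewrite exchange_big /=; under eq_bigr => i _.
  rewrite (bigD1 (s i)) //= eqxx big1 => [|v /negbTE]; last first.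
    by rewrite eq_sym => ->.
  rewrite addn0; over.
by rewrite sum1_card card_ord.
Qed.

Lemma fire_seq_balance s c k :
  (forall i, i < k -> deg G (s i) <= fire_seq G s c i (s i)) ->
  forall v, fire_seq G s c k v + deg G v * fired s k v =
            c v + nbsum (fired s k) v.
Proof.
elim: k => [|k IH] legal v.
  rewrite /= /fired big_ord0 muln0 [nbsum _ _]big1 // => w _.
  by rewrite big_ord0 muln0.
have {IH}/(_ v) IH := IH (fun i ik => legal i (ltnW ik)).
have nbS : nbsum (fired s k.+1) v = nbsum (fired s k) v + adj G (s k) v.
  rewrite -nbsum_dirac -nbsumD; apply: eq_bigr => w _.
  by rewrite firedS.
rewrite nbS addnA -IH firedS /= ffunE; case: eqVneq => [->|_].
  have := legal k (ltnSn k); rewrite adjxx /=; lia.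
lia.
Qed.

(* Least action principle: no legal firing sequence exceeds a stabilizing
   vector. *)
Lemma volatileP c : volatile G c <->
  forall u, exists v, deg G v * (u v).+1 <= c v + nbsum u v.
Proof.
split=> [[s legal] u|P].
  apply: contrapT => /forallNP nP.
  have le_u k : forall v, fired s k v <= u v.
    elim: k => [|k IH] v; first by rewrite /fired big_ord0.
    rewrite firedS; case: eqVneq => [->|_]; last by rewrite addn0.
    rewrite addn1 ltnNge; apply/negP => ge_u.
    apply: (nP (s k)).
    have := fire_seq_balance (fun i _ => legal i) (s k) (k := k).
    have := legal k; have := @leq_nbsum _ _ (s k) IH.
    have : deg G (s k) * u (s k) <= deg G (s k) * fired s k (s k).
      by rewrite leq_mul2l ge_u orbT.
    by rewrite mulnS; lia.
  have := @leq_sum _ (index_enum _) xpredT _ _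
    (fun v _ => le_u (\sum_v u v).+1 v).
  by rewrite sum_fired ltnn.
have [v0 _] := P (fun=> 0).
pose nxt u := odflt v0 [pick v | deg G v * (u v).+1 <= c v + nbsum u v].
have nxtP u : deg G (nxt u) * (u (nxt u)).+1 <= c (nxt u) + nbsum u (nxt u).
  rewrite /nxt; case: pickP => //= none.
  by have [v] := P u; rewrite none.
pose us k := iter k (fun u v => u v + (v == nxt u)) (fun=> 0).
pose s k := nxt (us k); exists s.
have usE k : us k = fired s k.
  elim: k => [|k IH]; apply/funext => v; first by rewrite /fired big_ord0.
  by rewrite firedS -IH.
elim/ltn_ind => k /fire_seq_balance/(_ (s k)); rewrite -usE.
by have := nxtP (us k); rewrite -/(s k) mulnS; lia.
Qed.

Lemma not_volatileP c : ~ volatile G c <-> exists u, stabilizes c u.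
Proof.
split=> [|[u cu] /volatileP/(_ u)[v]]; last by rewrite leqNgt cu.
move=> nv; apply: contrapT => /forallNP nP; apply: nv; apply/volatileP => u.
apply: contrapT => /forallNP nP'; apply: (nP u) => v.
by rewrite ltnNge; apply/negP/nP'.
Qed.

Lemma leq_volatile c b : (forall v, c v <= b v) -> volatile G c -> volatile G b.
Proof.
move=> cb /volatileP P; apply/volatileP => u; have [v Pv] := P u; exists v.
by rewrite (leq_trans Pv) ?leq_add2r.
Qed.

Lemma least_stabilizer c : ~ volatile G c -> exists x,
  [/\ stabilizes c x, forall v, deg G v * x v <= c v + nbsum x v &
      forall u, stabilizes c u -> forall v, x v <= u v].
Proof.
move=> /not_volatileP [u0 cu0].
have exm : exists m, `[< exists2 u, stabilizes c u & \sum_v u v = m >].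
  by exists (\sum_v u0 v); apply/asboolP; exists u0.
case: (ex_minnP exm) => m /asboolP[x cx sumx] minx.
have min_sum u : stabilizes c u -> \sum_v x v <= \sum_v u v.
  by move=> cu; rewrite sumx; apply: minx; apply/asboolP; exists u.
exists x; split=> //.
  move=> v; rewrite leqNgt; apply/negP => lt_deg.
  have xv : 0 < x v by move: lt_deg; case: (x v) => //; rewrite muln0.
  pose u w := x w - (w == v).
  have xE w : x w = u w + (w == v).
    by rewrite /u; case: eqVneq => [->|_] /=; lia.
  have /min_sum : stabilizes c u.
    move=> w; have := @leq_nbsum u x w (fun i => leq_subr _ _).
    have := cx w; rewrite (_ : u w = x w - (w == v)) //; case: eqVneq => [->|_] /=.
      by rewrite -subSn // subSS subn0; lia.
    by rewrite subn0; lia.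
  have uv : u v = x v - 1 by rewrite /u eqxx.
  rewrite (bigD1 v) //= [X in _ <= X](bigD1 v) //= uv.
  rewrite [X in _ <= _ + X](eq_bigr x) => [|i /negbTE]; first by lia.
  by rewrite /u => ->; rewrite subn0.
move=> u cu v; rewrite leqNgt; apply/negP => lt_ux.
pose m' w := minn (x w) (u w).
have /min_sum : stabilizes c m'.
  move=> w; rewrite {2}/m' /minn; case: ifP => _.
    apply: leq_ltn_trans (cx w); rewrite leq_add2l leq_nbsum // => i.
    exact: geq_minl.
  apply: leq_ltn_trans (cu w); rewrite leq_add2l leq_nbsum // => i.
  exact: geq_minr.
rewrite leqNgt => /negP; apply.
rewrite (bigD1 v) //= [X in _ < X](bigD1 v) //= -addSn leq_add //.
  by rewrite /m' gtn_min lt_ux orbT.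
by apply: leq_sum => i _; exact: geq_minl.
Qed.

Definition addc c b : config n := [ffun v => c v + b v].

Definition chips c := \sum_v c v.

Lemma chipsD c b : chips (addc c b) = chips c + chips b.
Proof. by rewrite -big_split; apply: eq_bigr => v _; rewrite ffunE. Qed.

Lemma stabilization c : ~ volatile G c -> exists z,
  [/\ forall v, z v < deg G v, chips z = chips c &
      forall b, volatile G (addc z b) <-> volatile G (addc c b)].
Proof.
move=> /least_stabilizer[x [cx legal least]].
pose z : config n := [ffun v => c v + nbsum x v - deg G v * x v]; exists z.
have zE v : z v + deg G v * x v = c v + nbsum x v by rewrite ffunE subnK.
  clearbody z.
split.
- by move=> v; have := cx v; rewrite -zE mulnS ltn_add2r.
- apply/eqP; rewrite -(eqn_add2r (\sum_v deg G v * x v)) -{2}sum_nbsum.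
  by rewrite -!big_split /=; apply/eqP; apply: eq_bigr => v _; rewrite zE.
move=> b; split=> /volatileP P; apply/volatileP => u; last first.
  have [v] := P (fun w => u w + x w); rewrite nbsumD !ffunE => Pv; exists v.
  have := zE v; rewrite -addSn mulnDr in Pv *; rewrite ffunE in Pv *; lia.
have [xu|] := pselect (forall v, x v <= u v).
  have [v] := P (fun w => u w - x w); rewrite ffunE => Pv; exists v.
  have : nbsum u v = nbsum (fun w => u w - x w) v + nbsum x v.
    by rewrite -nbsumD; apply: eq_bigr => w _; rewrite subnK.
  have := zE v; rewrite ffunE -subSn // mulnBr in Pv *.
  have : deg G v * x v <= deg G v * (u v).+1.
    by rewrite leq_mul2l leqW ?orbT.
  lia.
move=> nxu; apply: contrapT => /forallNP nP; apply: nxu; apply: least => v.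
by have /negP := nP v; rewrite ffunE -ltnNge; apply: leq_ltn_trans; lia.
Qed.

Lemma volatile_reduction c : volatile G c -> exists z,
  [/\ forall v, z v <= deg G v, chips z <= chips c & volatile G z].
Proof.
move=> vc.
have exm : exists m, `[< exists2 y, volatile G y & chips y = m >].
  by exists (chips c); apply/asboolP; exists c.
case: (ex_minnP exm) => m /asboolP[y vy sumy] miny.
have {}miny y' : volatile G y' -> chips y <= chips y'.
  by move=> vy'; rewrite sumy; apply: miny; apply/asboolP; exists y'.
have [y0|/existsNP[v /eqP y0]] := pselect (forall v, y v = 0).
  by exists y; split=> // [v|]; rewrite ?y0 ?miny.
pose y' : config n := [ffun w => y w - (w == v)].
pose e : config n := [ffun w => (w == v) : nat].
have yE : y = addc y' e.
  by apply/ffunP => w; rewrite !ffunE; case: eqVneq => [->|_] /=; lia.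
have tote : chips e = 1.
  rewrite /chips (bigD1 v) //= ffunE eqxx big1 // => w /negbTE vw.
  by rewrite ffunE vw.
have toty : chips y = (chips y').+1 by rewrite yE chipsD tote addn1.
have /stabilization[z [zdeg totz zP]] : ~ volatile G y'.
  by move=> /miny; rewrite toty ltnn.
exists (addc z e); split.
- move=> w; rewrite !ffunE; apply: leq_trans (zdeg w).
  by rewrite -addn1 leq_add2l leq_b1.
- by rewrite chipsD totz -chipsD -yE miny.
- by apply/zP; rewrite -yE.
Qed.

Lemma bounded_reduction c : exists z,
  [/\ forall v, z v <= deg G v, chips z <= chips c &
      forall b, volatile G (addc c b) -> volatile G (addc z b)].
Proof.
have [/volatile_reduction|/stabilization] := pselect (volatile G c) => -[z].
  move=> [zdeg totz vz]; exists z; split=> // b _.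
  by apply: leq_volatile vz => v; rewrite ffunE leq_addr.
move=> [zdeg totz zP]; exists z; split=> [v||b /zP//]; last by rewrite totz.
by rewrite ltnW.
Qed.

End ChipFiring.

Section Game.
Local Open Scope nat_scope.
Context (n : nat).
Implicit Types (c b : config n) (v w : 'I_n) (s h x y : seq 'I_n).

Definition cfg s : config n := [ffun v => count_mem v s].

Lemma addcA : associative (@addc n).
Proof. by move=> a b c; apply/ffunP => v; rewrite !ffunE addnA. Qed.

Lemma addcC : commutative (@addc n).
Proof. by move=> a b; apply/ffunP => v; rewrite !ffunE addnC. Qed.

Lemma cfg_cat s h : cfg (s ++ h) = addc (cfg s) (cfg h).
Proof. by apply/ffunP => v; rewrite !ffunE count_cat. Qed.

Lemma cfg_cons v s : cfg (v :: s) = addc (cfg [:: v]) (cfg s).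
Proof. by rewrite -cfg_cat. Qed.

Lemma addc0 c : addc c (cfg [::]) = c.
Proof. by apply/ffunP => v; rewrite !ffunE addn0. Qed.

Lemma chips_cfg s : chips (cfg s) = size s.
Proof.
elim: s => [|v s IH]; first by rewrite [chips _]big1 // => v _; rewrite ffunE.
rewrite -cat1s cfg_cat chipsD IH size_cat; congr (_ + _).
rewrite [chips _](bigD1 v) //= ffunE /= eqxx big1 // => w /negbTE vw.
by rewrite ffunE /= eq_sym vw.
Qed.

Lemma cfg_surj c : exists2 s, cfg s = c & size s = chips c.
Proof.
exists (flatten [seq nseq (c v) v | v <- enum 'I_n]).
  apply/ffunP => v; rewrite ffunE count_flatten -map_comp sumnE big_map.
  rewrite big_enum /= (bigD1 v) //= count_nseq /= eqxx mul1n.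
  by rewrite big1 ?addn0 // => w /negbTE vw; rewrite count_nseq /= vw.
rewrite size_flatten /shape -map_comp sumnE big_map big_enum /=.
by apply: eq_bigr => v _; rewrite /= size_nseq.
Qed.

Variable G : sgraph n.

Fixpoint min_wins k c : Prop :=
  if k is k'.+1 then forall v, exists w, min_wins k' (addc c (cfg [:: v; w]))
  else volatile G c.

Lemma volatile_wins k c : volatile G c -> min_wins k c.
Proof.
elim: k c => // k IH c vc v; exists v; apply: IH.
by apply: leq_volatile vc => i; rewrite ffunE leq_addr.
Qed.

Lemma min_wins_addl j k c : min_wins k c -> min_wins (j + k) c.
Proof.
rewrite addnC; elim: k c => [|k IH] c; first exact: volatile_wins.
by move=> wc v; have [w /IH ww] := wc v; exists w.
Qed.

Lemma min_wins_block y k c :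
  (forall x, size x = size y -> min_wins k (addc c (addc (cfg x) (cfg y)))) ->
  min_wins (size y + k) c.
Proof.
elim: y c => [|w y IH] c P.
  by have := P [::] erefl; rewrite !addc0.
move=> v; exists w; apply: IH => x sxy.
have := P (v :: x); rewrite /= sxy => /(_ erefl).
rewrite (cfg_cons v x) (cfg_cons w y) (cfg_cons v [:: w]).
rewrite -!addcA; congr (min_wins _ (addc _ (addc _ _))).
by rewrite addcA [addc (cfg x) _]addcC -addcA.
Qed.

Lemma min_wins_reply x k c : min_wins (size x + k) c ->
  exists2 y, size y = size x & min_wins k (addc c (addc (cfg x) (cfg y))).
Proof.
elim: x c => [|v x IH] c; first by exists [::]; rewrite ?addc0.
move=> /(_ v)[w /IH[y syx wy]]; exists (w :: y); first by rewrite /= syx.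
move: wy; rewrite (cfg_cons v x) (cfg_cons w y) (cfg_cons v [:: w]).
rewrite -!addcA; congr (min_wins _ (addc _ (addc _ _))).
by rewrite addcA [addc (cfg [:: w]) _]addcC -addcA.
Qed.

Lemma positionE (sMax sMin : strategy n) k :
  position sMax sMin k = cfg (moves sMax sMin k).
Proof. by []. Qed.

Lemma leq_position (sMax sMin : strategy n) k m v : k <= m ->
  position sMax sMin k v <= position sMax sMin m v.
Proof.
move=> /subnK <-; elim: (m - k) => // i; move/leq_trans; apply.
by rewrite addSn !ffunE /= -cats1 count_cat leq_addr.
Qed.

Lemma game_length_leP (sMax sMin : strategy n) k :
  game_length G sMax sMin <= k <-> volatile G (position sMax sMin k).
Proof.
rewrite /game_length; case: ex_minnP => m /asboolP vm minm; split.
  by move=> mk; apply: leq_volatile vm => v; exact: leq_position.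
by move=> vk; apply: minm; apply/asboolP.
Qed.

Lemma min_strategy k : min_wins k (cfg [::]) ->
  forall sMax : strategy n, exists sMin, game_length G sMax sMin <= k.*2.
Proof.
move=> wk sMax.
pose good h w := min_wins (k - (size h).+1./2) (cfg (rcons h w)).
pose sMin h := if pselect (exists w, good h w) is left e then projT1 (cid e)
  else sMax h.
exists sMin; apply/game_length_leP; rewrite positionE.
suff H i : i <= k -> min_wins (k - i) (cfg (moves sMax sMin i.*2)).
  by have := H k (leqnn k); rewrite subnn.
elim: i => [_|i IH ik]; first by rewrite subn0.
have := IH (ltnW ik); rewrite -(subnSK ik) doubleS /= odd_double /=.
set m := moves _ _ _ => /(_ (sMax m))[w].
rewrite -cfg_cat => ww; have {}ww : good (rcons m (sMax m)) w.
  by rewrite /good size_rcons size_moves /= doubleK -!cats1 -catA.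
rewrite /sMin; case: pselect => [e|[]]; last by exists w.
by case: cid => w' /=; rewrite /good size_rcons size_moves /= doubleK.
Qed.

Lemma max_strategy k (v0 : 'I_n) : ~ min_wins k (cfg [::]) ->
  exists sMax : strategy n, forall sMin, k.*2 < game_length G sMax sMin.
Proof.
move=> wk.
pose good h v := forall w, ~ min_wins (k - (size h)./2.+1) (cfg (h ++ [:: v; w])).
pose sMax h := if pselect (exists v, good h v) is left e then projT1 (cid e)
  else v0.
exists sMax => sMin; rewrite ltnNge; apply/negP => /game_length_leP.
rewrite positionE.
suff H i : i <= k -> ~ min_wins (k - i) (cfg (moves sMax sMin i.*2)).
  by have := H k (leqnn k); rewrite subnn.
elim: i => [_|i IH ik]; first by rewrite subn0.
have := IH (ltnW ik); rewrite -(subnSK ik) doubleS /= odd_double /=.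
set m := moves _ _ _ => /existsNP[v /forallNP nv].
have gv : good m v.
  by move=> w; rewrite size_moves doubleK cfg_cat; exact: nv.
rewrite /sMax; case: pselect => [e|[]]; last by exists v.
case: cid => v' /= /(_ (sMin (rcons m v'))).
by rewrite size_moves doubleK -!cats1 -catA.
Qed.

End Game.

Section TopplingNumber.
Context (R : realType) (n : nat) (G : sgraph n) (v0 : 'I_n).

Let len (sMax : strategy n) : set R :=
  [set (game_length G sMax sMin)%:R | sMin in [set: strategy n]]%classic.

Let len_lb sMax : has_lbound (len sMax).
Proof. by exists 0 => _ [sMin _ <-]. Qed.

Let len_ne sMax : (len sMax !=set0)%classic.
Proof.
by exists (game_length G sMax (fun=> v0))%:R; exists (fun=> v0).
Qed.

Let inf_le k sMax : min_wins G k (cfg [::]) -> inf (len sMax) <= k.*2%:R.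
Proof.
move=> wk; have [sMin le_k] := min_strategy wk sMax.
apply: (@le_trans _ _ (game_length G sMax sMin)%:R); last by rewrite ler_nat.
by apply: ge_inf; [exact: len_lb | exists sMin].
Qed.

Lemma min_wins_sum_deg : min_wins G (\sum_v deg G v) (cfg [::]).
Proof.
apply: contrapT => /(max_strategy v0)[sMax /(_ (fun=> v0))].
rewrite ltnNge (leq_trans (game_length_le _ _ _)) //.
by rewrite -addnn leq_addr.
Qed.

Lemma toppling_number_le k :
  min_wins G k (cfg [::]) -> toppling_number R G <= k.*2%:R.
Proof.
move=> wk; apply: ge_sup; first by exists (inf (len (fun=> v0))); exists (fun=> v0).
by move=> _ [sMax _ <-]; exact: inf_le.
Qed.

Lemma toppling_number_ge :
  exists2 k, min_wins G k (cfg [::]) & k.*2%:R - 1 <= toppling_number R G.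
Proof.
have exk : exists k, `[< min_wins G k (cfg [::]) >].
  by exists (\sum_v deg G v)%N; apply/asboolP/min_wins_sum_deg.
case: (ex_minnP exk) => k /asboolP wk mink; exists k => //.
have sup_ge sMax : inf (len sMax) <= toppling_number R G.
  apply: ub_le_sup; last by exists sMax.
  by exists k.*2%:R => _ [s _ <-]; exact: inf_le.
case: k wk mink => [|k] wk mink.
  apply: le_trans (sup_ge (fun=> v0)).
  apply: (@le_trans _ _ 0); first by rewrite double0 sub0r lerN10.
  by apply: lb_le_inf => // _ [sMin _ <-].
have /(max_strategy v0)[sMax gt_k] : ~ min_wins G k (cfg [::]).
  by move=> wk'; have := mink k; rewrite asboolT // => /(_ isT); rewrite ltnn.
apply: le_trans (sup_ge sMax); apply: lb_le_inf => // _ [sMin _ <-].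
by rewrite lerBlDr natr1 ler_nat doubleS ltnS.
Qed.

End TopplingNumber.

Section Simulation.
Context (R : realType) (n : nat).
Implicit Types (a b c z : config n) (v : 'I_n).

Lemma subconfig c m : (m <= chips c)%N ->
  exists2 b : config n, (forall v, b v <= c v)%N & chips b = m.
Proof.
have [s <- <-] := cfg_surj c => mc; exists (cfg (take m s)).
  by move=> v; rewrite !ffunE -{2}(cat_take_drop m s) count_cat leq_addr.
by rewrite chips_cfg size_takel.
Qed.

Lemma superconfig (v0 : 'I_n) c m : (chips c <= m)%N ->
  exists2 s, (forall v, c v <= cfg s v)%N & size s = m.
Proof.
have [s <- <-] := cfg_surj c => cm; exists (s ++ nseq (m - size s) v0).
  by move=> v; rewrite !ffunE count_cat leq_addr.
by rewrite size_cat size_nseq subnKC.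
Qed.

Lemma natr_chips c : (chips c)%:R = \sum_v (c v)%:R :> R.
Proof. exact: natr_sum. Qed.

Variables (G1 G2 : sgraph n) (r : R) (j1 j2 N e : nat) (v0 : 'I_n).
Hypothesis r_gt0 : 0 < r.
Hypothesis j12 : j2%:R + n%:R <= r * j1%:R.
Hypothesis j21 : j2%:R / r + n%:R <= j1%:R.

Definition scaled_degree v : R := r * (deg G1 v)%:R + (deg G2 v)%:R.

Hypothesis transfer : forall b c,
  (forall v, (b v)%:R <= N%:R * scaled_degree v) ->
  (forall v, (b v)%:R / r + e%:R <= (c v)%:R) ->
  volatile G2 b -> volatile G1 c.

Lemma covering_moves c e' : (chips c <= j2)%N ->
  exists2 y, size y = (j1 + n * e')%N &
    forall v, (c v)%:R / r + e'%:R <= (cfg y v)%:R.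
Proof.
move=> cj2.
pose b : config n := [ffun v => (Num.truncn ((c v)%:R / r)).+1 + e']%N.
have le_b v : (c v)%:R / r + e'%:R <= (b v)%:R.
  rewrite ffunE natrD lerD2r ltW //.
  by have /andP[] := truncn_itv (divr_ge0 (ler0n R (c v)) (ltW r_gt0)).
have /(superconfig v0)[y le_y sy] : (chips b <= j1 + n * e')%N.
  rewrite -(ler_nat R) natr_chips.
  apply: (@le_trans _ _ (\sum_v ((c v)%:R / r + 1 + e'%:R))).
    apply: ler_sum => v _; rewrite ffunE natrD lerD2r -natr1 lerD2r.
    by have /andP[] := truncn_itv (divr_ge0 (ler0n R (c v)) (ltW r_gt0)).
  rewrite !big_split /= -mulr_suml -natr_chips !sumr_const card_ord.
  rewrite natrD mulnC natrM mulr_natr lerD2r.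
  apply: le_trans j21; rewrite lerD2r ler_wpM2r ?invr_ge0 ?(ltW r_gt0) //.
  by rewrite ler_nat.
by exists y => // v; apply: le_trans (le_b v) _; rewrite ler_nat.
Qed.

(* Each block x of Max's moves is stabilized to z and translated into r z
   imagined moves; the imagined replies of Min are reduced to a bounded
   configuration, which Min copies during the next block. Here P and Q are the
   bounded configurations that stand for the positions c and a, except that Z
   has not yet been copied. *)
Lemma simulation_step i c a P Q Z : (i <= N)%N ->
  (forall b, volatile G1 (addc P b) -> volatile G1 (addc c b)) ->
  (forall b, volatile G2 (addc a b) -> volatile G2 (addc (addc Q Z) b)) ->
  (forall v, (Q v)%:R <= r * (P v)%:R) -> (chips Z <= j2)%N ->
  (forall v, (Q v + Z v)%N%:R <= (N - i)%:R * scaled_degree v) ->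
  min_wins G2 (i * j2) a -> min_wins G1 (i * j1 + (j1 + n * e)) c.
Proof.
elim: i c a P Q Z => [|i IH] c a P Q Z iN cP aQ QP Zj2 QZ wa.
  have [y sy le_y] := covering_moves e Zj2.
  rewrite mul0n add0n -sy -[size y]addn0; apply: min_wins_block => x sx /=.
  apply: (@leq_volatile _ _ (addc c (cfg y))).
    by move=> v; rewrite !ffunE leq_add2l leq_addl.
  apply: cP; apply: (@transfer (addc Q Z)).
  - by move=> v; rewrite ffunE; have := QZ v; rewrite subn0.
  - move=> v; rewrite !ffunE !natrD mulrDl -addrA; apply: lerD.
      by rewrite ler_pdivrMr // mulrC.
    by have := le_y v; rewrite ffunE.
  by have := aQ (cfg [::]); rewrite !addc0; apply.
have [y] := covering_moves 0 Zj2; rewrite muln0 addn0 => sy le_y.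
rewrite mulSn -addnA -[in X in min_wins _ X _]sy.
apply: min_wins_block => x; rewrite sy => sx.
have [vx|/stabilization[z [zdeg zchips zP]]] := pselect (volatile G1 (cfg x)).
  apply: volatile_wins; apply: leq_volatile vx => v.
  by rewrite !ffunE addnCA leq_addr.
pose A0 : config n := [ffun v => Num.truncn (r * (z v)%:R)].
have [] := @subconfig A0 j2.
  rewrite -(ler_nat R) -(lerD2r n%:R); apply: le_trans j12 _.
  rewrite -sx -(chips_cfg x) -zchips !natr_chips mulr_sumr.
  rewrite -[in X in _ <= _ + X](card_ord n) -sum1_card natr_sum -big_split /=.
  apply: ler_sum => v _; rewrite ffunE ltW // natr1.
  by have /andP[] := truncn_itv (mulr_ge0 (ltW r_gt0) (ler0n R (z v))).
move=> A leA chipsA; have [xA xAE sxA] := cfg_surj A.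
move: wa; rewrite mulSn -{1}chipsA -sxA => /min_wins_reply[y2 sy2 wa].
have [Z' [Z'deg Z'chips Z'P]] := bounded_reduction G2 (cfg y2).
have Az v : (A v)%:R <= r * (z v)%:R.
  have : ((A v)%:R : R) <= (A0 v)%:R by rewrite ler_nat.
  move/le_trans; apply; rewrite ffunE.
  by have /andP[] := truncn_itv (mulr_ge0 (ltW r_gt0) (ler0n R (z v))).
apply: (IH _ _ (addc (addc P (cfg y)) z) (addc (addc Q Z) A) Z' _ _ _ _ _ _ wa).
- exact: ltnW.
- move=> b vP.
  have /cP : volatile G1 (addc P (addc (addc (cfg y) z) b)).
    by rewrite !addcA in vP *.
  rewrite (_ : addc c _ = addc z (addc (addc c (cfg y)) b)); last first.
    by apply/ffunP => v; rewrite !ffunE; lia.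
  move=> /zP; congr volatile; apply/ffunP => v; rewrite !ffunE; lia.
- move=> b; rewrite -addcA => /aQ.
  rewrite (_ : addc _ _ = addc (cfg y2) (addc (addc (addc Q Z) A) b)).
    by move=> /Z'P; congr volatile; apply/ffunP => v; rewrite !ffunE; lia.
  by rewrite xAE; apply/ffunP => v; rewrite !ffunE; lia.
- move=> v; rewrite !ffunE !natrD !mulrDr lerD // lerD //.
  by have := le_y v; rewrite addr0 ler_pdivrMr // mulrC ffunE.
- by apply: leq_trans Z'chips _; rewrite chips_cfg sy2 sxA chipsA.
- move=> v; rewrite !ffunE natrD natrD -addrA.
  apply: (@le_trans _ _ ((N - i.+1)%:R * scaled_degree v + scaled_degree v)).
    apply: lerD; first exact: QZ.
    apply: lerD; last by rewrite ler_nat Z'deg.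
    apply: le_trans (Az v) _; rewrite ler_wpM2l ?(ltW r_gt0) // ler_nat.
    by rewrite ltnW.
  by rewrite -[X in _ + X]mul1r -mulrDl natr1 subnSK.
Qed.

Lemma simulation :
  min_wins G2 (N * j2) (cfg [::]) -> min_wins G1 (N * j1 + (j1 + n * e)) (cfg [::]).
Proof.
apply: (@simulation_step N _ _ (cfg [::]) (cfg [::]) (cfg [::])) => //.
- by move=> b; rewrite addc0.
- by move=> v; rewrite !ffunE mulr0.
- by rewrite chips_cfg.
- by move=> v; rewrite !ffunE subnn mul0r.
Qed.

End Simulation.

Section Mixing.
Context (R : realType) (n : nat) (G : sgraph n).
Implicit Types (v w : 'I_n) (S T : {set 'I_n}) (h : 'I_n -> nat).

Definition edge_count S T : nat := (\sum_(v in S) \sum_(w in T) adj G v w)%N.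

Record pseudorandom (p eta lam : R) : Prop := Pseudorandom {
  deg_near : forall v, `|(deg G v)%:R - p * n%:R| <= eta * (p * n%:R);
  cut_near : forall S T,
    `|(edge_count S T)%:R - p * #|S|%:R * #|T|%:R| <= eta * (p * n%:R) * n%:R;
  edge_count_le : forall S T,
    (edge_count S T)%:R <=
      2 * p * #|S|%:R * #|T|%:R + lam * (#|S|%:R + #|T|%:R) }.

Fixpoint level i : nat := if i is i'.+1 then (3 * (level i').+1)%N else 0%N.

Lemma level_le i : (level i <= 2 * 3 ^ i - 2)%N.
Proof.
elim: i => //= i IH; rewrite expnS.
by have := expn_gt0 3 i; lia.
Qed.

Definition sublevel C h i : {set 'I_n} := [set v | h v <= C * level i]%N.

Lemma edge_countC S T :
  (edge_count S T + edge_count S (~: T) = \sum_(v in S) deg G v)%N.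
Proof.
rewrite -big_split /=; apply: eq_bigr => v _.
rewrite deg_sum [RHS](bigID [in T]) /=; congr (_ + _)%N.
by apply: eq_bigl => w; rewrite inE.
Qed.

(* Markov's inequality among the neighbours of each vertex of the sublevel. *)
Lemma sublevel_exits C h i : (0 < C)%N ->
  (forall v, nbsum G h v <= deg G v * (h v + C))%N ->
  (3 * edge_count (sublevel C h i) (~: sublevel C h i.+1) <=
   \sum_(v in sublevel C h i) deg G v)%N.
Proof.
move=> C0 hP; rewrite /edge_count big_distrr /=; apply: leq_sum => v.
rewrite inE => hv; rewrite -(@leq_pmul2r (C * (level i).+1)) ?muln_gt0 ?C0 //.
rewrite mulnAC -mulnA mulnC -mulnA mulnCA [X in (_ * X)%N]mulnC.
apply: (@leq_trans (nbsum G h v)); last first.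
  apply: leq_trans (hP v) _.
  by rewrite leq_mul2l mulnS [(C + _)%N]addnC leq_add2r hv orbT.
rewrite big_distrl /= /nbsum [leqRHS](bigID [in ~: sublevel C h i.+1]) /=.
apply: leq_trans (leq_addr _ _); apply: leq_sum => w; rewrite !inE -ltnNge /=.
by move=> /ltnW hw; rewrite leq_mul2l; lia.
Qed.

Variables (p eta lam : R).
Hypothesis prG : pseudorandom p eta lam.

Local Notation d := (p * n%:R).

Lemma sum_ltn m H : (\sum_(j < H) (j < m) = minn H m)%N.
Proof.
elim: H => [|H IH]; first by rewrite big_ord0 min0n.
by rewrite big_ord_recr /= IH; case: (ltnP H m); lia.
Qed.

Lemma nbsum_near h H S : (forall v, h v <= H)%N ->
  `|(\sum_(v in S) nbsum G h v)%N%:R - p * #|S|%:R * (\sum_v h v)%N%:R|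
    <= H%:R * (eta * d * n%:R).
Proof.
move=> hH.
have cake v : h v = (\sum_(j < H) (j < h v))%N.
  by rewrite sum_ltn; apply/esym/minn_idPr.
pose T (j : 'I_H) : {set 'I_n} := [set w | j < h w]%N.
have -> : (\sum_v h v = \sum_(j < H) #|T j|)%N.
  under eq_bigr do rewrite cake; rewrite exchange_big; apply: eq_bigr => j _ /=.
  rewrite -sum1_card [RHS]big_mkcond; apply: eq_bigr => w _.
  by rewrite inE; case: ltnP.
have nbE v : nbsum G h v = (\sum_(j < H) \sum_(w in T j) adj G v w)%N.
  under [RHS]eq_bigr do rewrite big_mkcond.
  rewrite exchange_big /=; apply: eq_bigr => w _; rewrite {1}cake big_distrr.
  apply: eq_bigr => j _; rewrite inE.
  by case: (j < h w)%N => /=; rewrite ?muln1 ?muln0.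
have -> : (\sum_(v in S) nbsum G h v = \sum_(j < H) edge_count S (T j))%N.
  by under eq_bigr do rewrite nbE; rewrite exchange_big.
rewrite !natr_sum mulr_sumr -sumrB; apply: le_trans (ler_norm_sum _ _ _) _.
apply: (@le_trans _ _ (\sum_(j < H) eta * d * n%:R)).
  by apply: ler_sum => j _; exact: (cut_near prG).
by rewrite sumr_const card_ord mulr_natl.
Qed.

Hypotheses (p_gt0 : 0 < p) (n_gt0 : (0 < n)%N).
Hypotheses (eta_le : eta <= 1 / 100) (lam_gt0 : 0 < lam).

Lemma d_gt0 : 0 < d.
Proof. by rewrite mulr_gt0 ?ltr0n. Qed.

Lemma deg_bounds v : (1 - eta) * d <= (deg G v)%:R <= (1 + eta) * d.
Proof. by have := deg_near prG v; rewrite ler_norml => /andP[]; lra. Qed.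

Lemma sum_deg_bounds S :
  (1 - eta) * d * #|S|%:R <= (\sum_(v in S) deg G v)%N%:R <=
  (1 + eta) * d * #|S|%:R.
Proof.
rewrite natr_sum -!sum1_card natr_sum !mulr_sumr.
by apply/andP; split; apply: ler_sum => v _; rewrite mulr1;
  have /andP[] := deg_bounds v.
Qed.

Lemma sublevel_expands C h i : (0 < C)%N ->
  (forall v, nbsum G h v <= deg G v * (h v + C))%N ->
  #|sublevel C h i.+1|%:R <= n%:R / 10 :> R ->
  d / (5 * lam) * #|sublevel C h i|%:R <= #|sublevel C h i.+1|%:R.
Proof.
move=> C0 hP; have := sublevel_exits i C0 hP.
have := edge_countC (sublevel C h i) (sublevel C h i.+1).
have := edge_count_le prG (sublevel C h i) (sublevel C h i.+1).
have /andP[+ _] := sum_deg_bounds (sublevel C h i).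
have : (#|sublevel C h i| <= #|sublevel C h i.+1|)%N.
  apply/subset_leq_card/fintype.subsetP => v; rewrite !inE => /leq_trans; apply.
  by rewrite leq_mul2l /=; lia.
move: (sublevel C h i) (sublevel C h i.+1) => S T.
rewrite -(ler_nat R); set s : R := #|S|%:R; set t : R := #|T|%:R.
move=> st + + + + tn; set D := (\sum_(v in S) _)%N.
move=> Dge e1 eD e2; have {}e2 : 3 * (edge_count S (~: T))%:R <= D%:R :> R.
  by rewrite -natrM ler_nat.
have {}eD : (edge_count S T)%:R + (edge_count S (~: T))%:R = D%:R :> R.
  by rewrite -natrD eD.
have s0 : 0 <= s by rewrite ler0n.
have ds : 0 <= d * s by rewrite mulr_ge0 // ltW ?d_gt0.
have H1 : 2 * p * s * t <= d * s / 5.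
  have -> : 2 * p * s * t = 2 * (p * s) * t by rewrite !mulrA.
  have -> : d * s / 5 = 2 * (p * s) * (n%:R / 10) by field.
  by rewrite ler_wpM2l // mulr_ge0 // mulr_ge0 // ltW.
have H2 : eta * (d * s) <= 1 / 100 * (d * s) by rewrite ler_wpM2r.
have H3 : lam * s <= lam * t by rewrite ler_wpM2l // ltW.
have -> : d / (5 * lam) * s = d * s / (5 * lam) by rewrite mulrAC.
rewrite ler_pdivrMr ?mulr_gt0 //; nra.
Qed.

Lemma sublevel_majority C h i : (0 < C)%N ->
  (forall v, nbsum G h v <= deg G v * (h v + C))%N ->
  n%:R / 10 <= #|sublevel C h i|%:R :> R ->
  n%:R / 2 < #|sublevel C h i.+1|%:R :> R.
Proof.
move=> C0 hP; have := sublevel_exits i C0 hP.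
have := cut_near prG (sublevel C h i) (~: sublevel C h i.+1).
have /andP[_] := sum_deg_bounds (sublevel C h i).
have := cardsCs (sublevel C h i.+1); rewrite card_ord.
move: (sublevel C h i) (sublevel C h i.+1) => S T.
have : (#|~: T| <= n)%N by rewrite -[leqRHS]card_ord max_card.
move=> ? TE; have {TE} -> : #|T|%:R = n%:R - #|~: T|%:R :> R.
  by rewrite TE natrB.
rewrite ler_norml -(ler_nat R (3 * _)) natrM.
set s : R := #|S|%:R; set t : R := #|~: T|%:R; set e : R := (edge_count _ _)%:R.
move=> Dle /andP[cut _] e3 sn.
have n0 : 0 < n%:R :> R by rewrite ltr0n.
have s0 : 0 < s by lra.
have ds : 0 < d * s by rewrite mulr_gt0 ?d_gt0.
have H1 : eta * d * n%:R <= d * s / 10.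
  apply: (@le_trans _ _ (1 / 100 * (d * n%:R))).
    by rewrite -mulrA ler_wpM2r // mulr_ge0 ?ltW ?d_gt0.
  have -> : d * s / 10 = 1 / 100 * (d * (10 * s)) by field.
  by rewrite ler_wpM2l // ler_wpM2l ?(ltW d_gt0) //; lra.
have H2 : eta * (d * s) <= 1 / 100 * (d * s) by rewrite ler_wpM2r // ltW.
have : p * s * t <= p * s * (45 / 100 * n%:R) by lra.
by rewrite ler_pM2l ?mulr_gt0 //; lra.
Qed.

Lemma sublevel_large C h v0 k : (0 < C)%N -> h v0 = 0%N ->
  (forall v, nbsum G h v <= deg G v * (h v + C))%N ->
  n%:R <= (d / (5 * lam)) ^+ k ->
  n%:R / 2 < #|sublevel C h k.+1|%:R :> R.
Proof.
move=> C0 h0 hP nk; apply: sublevel_majority => //.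
have D0 : 0 <= d / (5 * lam) by rewrite ltW // divr_gt0 ?d_gt0 // mulr_gt0.
have n0 : 0 <= n%:R :> R by [].
suff H i : n%:R / 10 <= #|sublevel C h i|%:R :> R \/
    (d / (5 * lam)) ^+ i <= #|sublevel C h i|%:R.
  by have [//|] := H k; lra.
elim: i => [|i IH].
  right; rewrite expr0 ler1n card_gt0; apply/set0Pn; exists v0.
  by rewrite inE h0.
have /orP[|/(sublevel_expands C0 hP) ge_i] :=
    le_total (n%:R / 10) (#|sublevel C h i.+1|%:R : R); first by left.
case: IH => [IH|IH].
  left; apply: le_trans IH _; rewrite ler_nat.
  apply/subset_leq_card/fintype.subsetP => v.
  by rewrite !inE => /leq_trans; apply; rewrite leq_mul2l /=; lia.
right; rewrite exprS; apply: le_trans ge_i.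
by rewrite ler_wpM2l.
Qed.

Lemma bounded_of_almost_harmonic C h v0 k : (0 < C)%N -> h v0 = 0%N ->
  (forall v, nbsum G h v <= deg G v * (h v + C))%N ->
  (forall v, deg G v * h v <= nbsum G h v + deg G v * C)%N ->
  n%:R <= (d / (5 * lam)) ^+ k ->
  forall v, (h v <= C * (12 * 3 ^ k))%N.
Proof.
move=> C0 h0 hP hP' nk v.
pose b := (\max_w h w)%N; pose h' w := (b - h w)%N.
have hb w : (h w <= b)%N by exact: leq_bigmax.
have [|vm bE] := @bigop.eq_bigmax _ h; first by rewrite card_ord.
have hP'' w : (nbsum G h' w <= deg G w * (h' w + C))%N.
  have : (nbsum G h' w + nbsum G h w = deg G w * b)%N.
    by rewrite -nbsumD -nbsum_cst; apply: eq_bigr => i _; rewrite subnK.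
  have : (deg G w * h' w + deg G w * h w = deg G w * b)%N.
    by rewrite -mulnDr subnK.
  by have := hP' w; rewrite mulnDr; lia.
have := sublevel_large C0 h0 hP nk.
have /(sublevel_large C0)/(_ hP'' nk) : h' vm = 0%N by rewrite /h' /b bE subnn.
set S := sublevel _ _ _; set T := sublevel _ _ _ => nS nT.
have : (0 < #|S :&: T|)%N.
  have := cardsUI S T; have : (#|S :|: T| <= n)%N.
    by rewrite -[leqRHS]card_ord max_card.
  have : (n < #|S| + #|T|)%N by rewrite -(ltr_nat R) natrD; lra.
  by lia.
rewrite card_gt0 => /set0Pn[w]; rewrite !inE => /andP[].
have := hb w; have := hb v; rewrite /h'; have := level_le k.+1; rewrite expnS.
move=> lv; have : (C * level k.+1 <= C * (6 * 3 ^ k))%N by rewrite leq_mul2l; lia.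
lia.
Qed.

End Mixing.

Section ParallelFiring.
Local Open Scope nat_scope.
Context (n : nat) (G : sgraph n) (b : config n) (M : nat).
Hypotheses (M_gt1 : 1 < M) (b_vol : volatile G b).
Hypothesis b_lt : forall v, b v < M * deg G v.

(* Firing all unstable vertices at once preserves b_lt, and the vertices of a
   round may be fired one at a time, so that every total is reached. *)
Lemma parallel_firing S : exists x : 'I_n -> nat, [/\ \sum_v x v = S,
  forall v, deg G v * x v <= b v + nbsum G x v &
  forall v, b v + nbsum G x v <= deg G v * (x v + M.+1)].
Proof.
pose F (x : 'I_n -> nat) v := deg G v * (x v).+1 <= b v + nbsum G x v.
pose stage (x : 'I_n -> nat) := forall v,
  deg G v * x v <= b v + nbsum G x v < deg G v * (x v + M).
suff [x [y [xs xy yS]]] : exists x y, [/\ stage x,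
    forall v, x v <= y v <= x v + F x v & \sum_v y v = S].
  exists y; split=> // v; have /andP[xv vx] := xy v; have /andP[sv vs] := xs v.
    have le_nb : nbsum G x v <= nbsum G y v.
      by apply: leq_nbsum => w; have /andP[] := xy w.
    move: vx; case Fv: (F x v).
      rewrite /= addn1 => vx; apply: leq_trans (_ : deg G v * (x v).+1 <= _).
        by rewrite leq_mul2l vx orbT.
      by apply: leq_trans Fv _; rewrite leq_add2l.
    rewrite /= addn0 => vx; have -> : y v = x v by apply/eqP; rewrite eqn_leq vx.
    by apply: leq_trans sv _; rewrite leq_add2l.
  have le_nb : nbsum G y v <= nbsum G x v + deg G v.
    rewrite -[deg G v]muln1 -nbsum_cst -nbsumD; apply: leq_nbsum => w.
    by have /andP[_ wx] := xy w; apply: leq_trans wx _; rewrite leq_add2l leq_b1.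
  apply: leq_trans (_ : deg G v * (x v + M.+1) <= _).
    by rewrite addnS mulnS; lia.
  by rewrite leq_mul2l leq_add2r xv orbT.
elim: S => [|S [x [y [xs xy yS]]]].
  exists (fun=> 0), (fun=> 0); split=> [v|v|]; last by rewrite big1.
    by rewrite nbsum_cst !muln0 addn0 mulnC b_lt.
  by [].
have addS z v : \sum_i (z i + (i == v)) = (\sum_i z i).+1.
  have s1 : \sum_i (i == v) = 1.
    by rewrite (bigD1 v) //= eqxx big1 // => i /negbTE ->.
  by rewrite big_split /= s1 addn1.
have [[v [Fv yv]]|none] := pselect (exists v, F x v /\ y v = x v).
  exists x, (fun i => y i + (i == v)); split=> //; last by rewrite addS yS.
  move=> w; have /andP[xw wx] := xy w; case: eqVneq => [->|_].
    by rewrite yv Fv leq_addr leqnn.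
  by rewrite addn0 xw.
have yE v : y v = x v + F x v.
  have /andP[xv vx] := xy v; apply/eqP; rewrite eqn_leq vx /=.
  case Fv: (F x v); last by rewrite addn0.
  rewrite /= addn1 ltn_neqAle xv andbT; apply/eqP => xyv.
  by apply: none; exists v.
have ys : stage y.
  move=> v; have /andP[sv vs] := xs v.
  have le_nb : nbsum G x v <= nbsum G y v.
    by apply: leq_nbsum => w; rewrite yE leq_addr.
  have nb_le : nbsum G y v <= nbsum G x v + deg G v.
    rewrite -[deg G v]muln1 -nbsum_cst -nbsumD; apply: leq_nbsum => w.
    by rewrite yE leq_add2l leq_b1.
  rewrite yE; case Fv: (F x v) => /=.
    rewrite addn1 (leq_trans Fv) ?leq_add2l //= addSn mulnS; lia.
  move/negbT: Fv; rewrite /F -ltnNge addn0 => Fv.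
  rewrite (leq_trans sv) ?leq_add2l //=.
  apply: (@leq_trans (deg G v * (x v).+2)); first by rewrite [X in _ < X]mulnS; lia.
  by rewrite leq_mul2l -addn2 leq_add2l M_gt1 orbT.
have [v Fv] := (volatileP G b).1 b_vol y.
exists y, (fun i => y i + (i == v)); split=> //; last by rewrite addS yS.
move=> w; rewrite leq_addr leq_add2l /=; case: eqVneq => [->|//].
by rewrite /F Fv.
Qed.

End ParallelFiring.

Section CompleteGraph.
Local Open Scope nat_scope.
Context (n : nat).
Implicit Types (a : config n) (v : 'I_n).

Lemma adj_complete v w : adj (complete_graph n) v w = (v != w).
Proof. by rewrite /adj /edges /= inE cards2; case: (v != w). Qed.

Lemma nbsum_complete u v :
  nbsum (complete_graph n) u v + u v = \sum_w u w.
Proof.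
rewrite /nbsum (bigD1 v) //= [RHS](bigD1 v) //= adj_complete eqxx mul0n add0n.
rewrite addnC; congr (_ + _); apply: eq_bigr => w wv.
by rewrite adj_complete eq_sym wv mul1n.
Qed.

Lemma deg_complete v : (deg (complete_graph n) v).+1 = n.
Proof.
have := nbsum_complete (fun=> 1) v.
by rewrite nbsum_cst muln1 addn1 sum1_card card_ord.
Qed.

Lemma volatile_complete_fire a u v :
  (deg (complete_graph n) v * (u v).+1 <= a v + nbsum (complete_graph n) u v) =
  (n * (u v).+1 <= a v + (\sum_w u w).+1).
Proof.
have -> : n * (u v).+1 = deg (complete_graph n) v * (u v).+1 + (u v).+1.
  by rewrite -mulSnr deg_complete.
by rewrite -(nbsum_complete u v); apply/idP/idP; lia.
Qed.

Lemma volatile_completeP a : volatile (complete_graph n) a <->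
  forall S, S < \sum_v (a v + S.+1) %/ n.
Proof.
split=> [/volatileP P S|P].
  rewrite ltnNge; apply/negP => leS.
  have [v] := P (fun v => (a v + S.+1) %/ n); rewrite volatile_complete_fire.
  have n0 : 0 < n by apply: leq_ltn_trans (ltn_ord v).
  rewrite leqNgt => /negP; apply.
  apply: leq_ltn_trans (_ : a v + S.+1 < _); first by rewrite leq_add2l.
  by rewrite mulnC ltn_ceil.
apply/volatileP => u; apply: contrapT => /forallNP nP.
have := P (\sum_w u w); rewrite ltnNge => /negP; apply; apply: leq_sum => v _.
have := nP v; rewrite volatile_complete_fire => /negP; rewrite -ltnNge.
have n0 : 0 < n by apply: leq_ltn_trans (ltn_ord v).
by rewrite mulnC -ltn_divLR // ltnS.
Qed.

End CompleteGraph.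

Section Transfer.
Context (R : realType) (n : nat) (G : sgraph n) (p eta lam : R).
Hypotheses (prG : pseudorandom G p eta lam) (p_gt0 : 0 < p) (n_gt0 : (0 < n)%N).
Hypotheses (eta_ge0 : 0 <= eta) (eta_le : eta <= 1 / 100) (lam_gt0 : 0 < lam).

Local Notation d := (p * n%:R).

Variables (L k : nat) (eps : R).
Hypotheses (L_gt0 : (0 < L)%N) (eps_gt0 : 0 < eps) (eps_le1 : eps <= 1).
Hypothesis k_large : n%:R <= (d / (5 * lam)) ^+ k.

Definition spread : nat := ((2 * L).+2 * (12 * 3 ^ k)).+1.

Local Notation kappa := (spread%:R * eta).

Hypothesis kappa_small : kappa * (100 * (L + 4)%:R) <= eps ^+ 2.
Hypotheses (n_large : 8 <= eps * n%:R) (d_large : 8 <= eps * d).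

Implicit Types (a b c : config n) (v : 'I_n) (h : 'I_n -> nat).

Let d0 : 0 < d. Proof. exact: (d_gt0 p_gt0 n_gt0). Qed.
Let n0 : 0 < n%:R :> R. Proof. by rewrite ltr0n. Qed.
Let kappa0 : 0 <= kappa. Proof. by rewrite mulr_ge0. Qed.

Definition exceptional h : {set 'I_n} :=
  [set v | eps / 4 * d < `|(nbsum G h v)%:R - p * (\sum_w h w)%N%:R|].

Lemma sum_exceptional h (S : {set 'I_n}) : (forall v, h v <= spread)%N ->
  `|(\sum_(v in S) nbsum G h v)%N%:R - p * #|S|%:R * (\sum_v h v)%N%:R|
    <= kappa * (d * n%:R).
Proof.
by move=> hH; apply: le_trans (nbsum_near prG S hH) _; rewrite !mulrA.
Qed.

Lemma card_exceptional h : (forall v, h v <= spread)%N ->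
  eps * #|exceptional h|%:R <= 8 * kappa * n%:R.
Proof.
move=> hH; set U : R := (\sum_w h w)%N%:R.
pose S1 : {set 'I_n} := [set v | eps / 4 * d < (nbsum G h v)%:R - p * U].
pose S2 : {set 'I_n} := [set v | eps / 4 * d < p * U - (nbsum G h v)%:R].
have card_le : #|exceptional h|%:R <= #|S1|%:R + #|S2|%:R :> R.
  rewrite -natrD ler_nat; apply: leq_trans (_ : #|S1 :|: S2| <= _)%N.
    apply/subset_leq_card/fintype.subsetP => v; rewrite !inE -/U lter_normr /=.
    by rewrite opprB.
  by rewrite cardsU leq_subr.
have sumc (S : {set 'I_n}) (x : R) : \sum_(v in S) x = #|S|%:R * x.
  by rewrite sumr_const mulr_natl.
have le1 : #|S1|%:R * (eps / 4 * d) <= kappa * (d * n%:R).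
  have := sum_exceptional S1 hH; rewrite ler_norml => /andP[_].
  apply: le_trans; rewrite -sumc -/U natr_sum.
  have -> : p * #|S1|%:R * U = \sum_(v in S1) p * U by rewrite sumc; ring.
  by rewrite -sumrB; apply: ler_sum => v; rewrite inE => /ltW.
have le2 : #|S2|%:R * (eps / 4 * d) <= kappa * (d * n%:R).
  have := sum_exceptional S2 hH; rewrite distrC ler_norml => /andP[_].
  apply: le_trans; rewrite -sumc -/U natr_sum.
  have -> : p * #|S2|%:R * U = \sum_(v in S2) p * U by rewrite sumc; ring.
  by rewrite -sumrB; apply: ler_sum => v; rewrite inE => /ltW.
rewrite -(ler_pM2r d0).
apply: (@le_trans _ _ (eps * (#|S1|%:R + #|S2|%:R) * d)).
  by rewrite ler_pM2r // ler_pM2l.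
lra.
Qed.

Lemma exceptional_budget h : (forall v, h v <= spread)%N ->
  (L + 3)%:R * #|exceptional h|%:R + kappa * n%:R <= eps * n%:R / 4 - 1.
Proof.
move=> /card_exceptional; set be : R := #|_|%:R => cardB.
rewrite -(ler_pM2l eps_gt0).
have H1 : (L + 3)%:R * (eps * be) <= (L + 3)%:R * (8 * kappa * n%:R).
  by rewrite ler_wpM2l.
have H2 : eps * (kappa * n%:R) <= 1 * (kappa * n%:R).
  by rewrite ler_wpM2r // mulr_ge0 // ltW.
have H3 : kappa * (100 * (L + 4)%:R) * n%:R <= eps ^+ 2 * n%:R.
  by rewrite ler_wpM2r // ltW.
have H4 : eps * 8 <= eps * (eps * n%:R) by rewrite ler_pM2l.
have H5 : 0 <= L%:R * (kappa * n%:R) by rewrite !mulr_ge0 // ltW.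
have H6 : 0 <= kappa * n%:R by rewrite mulr_ge0 // ltW.
move: H1 H3; rewrite !natrD; lra.
Qed.

Lemma kappa_le : kappa <= eps / 8.
Proof.
have H : kappa * 400 <= kappa * (100 * (L + 4)%:R).
  rewrite ler_wpM2l // natrD.
  by have : 0 <= L%:R :> R by []; lra.
have := le_trans H kappa_small.
have : eps ^+ 2 <= eps * 1 by rewrite expr2 ler_wpM2l // ltW.
by have := eps_gt0; lra.
Qed.

Lemma eta_mul_le h v : (h v <= spread)%N ->
  eta * (d * (h v)%:R) <= eps / 8 * d.
Proof.
move=> hv; apply: le_trans (_ : kappa * d <= _); last first.
  by rewrite ler_wpM2r ?kappa_le // ltW.
have -> : eta * (d * (h v)%:R) = (h v)%:R * (eta * d) by ring.
have -> : kappa * d = spread%:R * (eta * d) by ring.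
by rewrite ler_wpM2r ?ler_nat // mulr_ge0 // ltW.
Qed.

Lemma min_vertex (x : 'I_n -> nat) : exists v0, forall v, (x v0 <= x v)%N.
Proof.
pose i0 := Ordinal n_gt0; exists [arg min_(i < i0) x i]%N => v.
by case: arg_minnP => // i _; apply.
Qed.

Lemma bounded_of_legal x :
  (forall v, nbsum G x v <= deg G v * (x v + (2 * L).+2))%N ->
  (forall v, deg G v * x v <= nbsum G x v + deg G v * (2 * L).+2)%N ->
  exists m, (forall v, m <= x v)%N /\ (forall v, x v - m < spread)%N.
Proof.
move=> xu xl; have [v0 minx] := min_vertex x; exists (x v0); split=> // v.
rewrite ltnS.
pose h v := (x v - x v0)%N.
have degE w : (deg G w * x w = deg G w * h w + deg G w * x v0)%N.
  by rewrite -mulnDr subnK.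
have nbE w : (nbsum G x w = nbsum G h w + deg G w * x v0)%N.
  by rewrite -nbsum_cst -nbsumD; apply: eq_bigr => i _; rewrite subnK.
apply: (@bounded_of_almost_harmonic _ _ _ _ _ _ prG _ _ _ _ _ h v0) => //.
- by rewrite /h subnn.
- by move=> w; have := xu w; rewrite !mulnDr nbE degE addnAC leq_add2r.
- by move=> w; have := xl w; rewrite nbE degE addnAC leq_add2r.
Qed.

Lemma deg_lower v : 99 / 100 * d <= (deg G v)%:R.
Proof.
have /andP[+ _] := deg_bounds prG v; apply: le_trans.
by rewrite ler_pM2r //; have := eta_le; lra.
Qed.

Lemma volatile_complete_of_random a b :
  (forall v, (b v)%:R <= L%:R * d) ->
  (forall v, (b v)%:R / p + eps * n%:R <= (a v)%:R) ->
  volatile G b -> volatile (complete_graph n) a.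
Proof.
move=> bL ba vb; apply/volatile_completeP => S.
have b_lt v : (b v < (2 * L).+1 * deg G v)%N.
  rewrite -(ltr_nat R) natrM -natr1 natrM; apply: le_lt_trans (bL v) _.
  apply: (@lt_le_trans _ _ ((2 * L%:R + 1) * (99 / 100 * d))); last first.
    by apply: ler_wpM2l (deg_lower v); rewrite addr_ge0 // mulr_ge0.
  have : 0 <= L%:R * d by rewrite mulr_ge0 // ltW.
  by have := d0; lra.
pose g := Num.truncn (eps * n%:R / 4).
have /andP[g_le g_gt] : g%:R <= eps * n%:R / 4 < g.+1%:R.
  by apply: truncn_itv; rewrite divr_ge0 // mulr_ge0 // ltW.
have g_le_n : (g <= n)%N.
  rewrite -(ler_nat R); apply: le_trans g_le _.
  have : eps * n%:R <= 1 * n%:R by rewrite ler_wpM2r.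
  by have := n0; lra.
have M_gt1 : (1 < (2 * L).+1)%N by rewrite ltnS muln_gt0.
have [x [sumx xl xu]] := parallel_firing M_gt1 vb b_lt (S.+1 + g).
have [|w|m [m_le hH]] := @bounded_of_legal x.
- by move=> w; apply: leq_trans (xu w); rewrite leq_addl.
- apply: leq_trans (xl w) _; rewrite addnC leq_add2l mulnC.
  by apply: leq_trans (ltnW (b_lt w)) _; rewrite leq_mul2r leqnSn orbT.
pose h v := (x v - m).+1.
have xE v : (x v + 1 = h v + m)%N by rewrite /h addn1 addSn subnK.
set U := (\sum_v h v)%N.
have UE : (U + n * m = S.+1 + g + n)%N.
  have : (\sum_v (x v + 1) = \sum_v (h v + m))%N by apply: eq_bigr.
  by rewrite !big_split /= sumx !sum_nat_const !card_ord muln1.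
have legal v : (deg G v * h v <= b v + nbsum G h v)%N.
  rewrite -(leq_add2r (deg G v * m)) -mulnDr -xE.
  rewrite -addnA -(nbsum_cst G m) -nbsumD.
  have -> : nbsum G (fun w => h w + m)%N v = (nbsum G x v + deg G v * 1)%N.
    by rewrite -nbsum_cst -nbsumD; apply: eq_bigr => w _; rewrite xE.
  by rewrite mulnDr addnA leq_add2r.
pose q v := ((a v + (U - g)) %/ n)%N.
have n_le_U : (n <= U)%N.
  by rewrite -[leqLHS]card_ord -sum1_card; apply: leq_sum.
have g_le_U : (g <= U)%N := leq_trans g_le_n n_le_U.
suff main : (U - g <= \sum_v q v)%N.
  have : (\sum_v (1 + (a v + S.+1) %/ n) = \sum_v (m + q v))%N.
    apply: eq_bigr => v _; rewrite -!divnMDl //; congr (_ %/ n)%N.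
    move: UE g_le_U (a v); rewrite mul1n [(m * n)%N]mulnC.
    by generalize U g (n * m)%N; clear; lia.
  rewrite !big_split /= !sum_nat_const !card_ord muln1.
  move: main UE g_le_U; set sq := (\sum_v q v)%N; set sa := (\sum_v _)%N.
  by generalize U sq sa g (n * m)%N; clear; lia.
set B := exceptional h; have h_le v : (h v <= spread)%N := hH v.
have UR : (U%:R : R) = \sum_v (h v)%:R by rewrite natr_sum.
have legalR v : d * (h v)%:R - eps / 8 * d <= (b v)%:R + (nbsum G h v)%:R.
  have : ((deg G v * h v)%N%:R : R) <= (b v + nbsum G h v)%N%:R by rewrite ler_nat.
  rewrite natrM natrD; apply: le_trans.
  apply: (@le_trans _ _ ((1 - eta) * d * (h v)%:R)).
    by have := eta_mul_le (h_le v); lra.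
  by rewrite ler_wpM2r //; have /andP[] := deg_bounds prG v.
have good v : v \notin B -> (h v <= q v)%N.
  rewrite inE -leNgt -/U ler_norml => /andP[_ vB].
  rewrite leq_divRL // -(ler_nat R) natrM natrD natrB //.
  rewrite -(ler_pM2l p_gt0).
  have H1 : (b v)%:R + eps * d <= p * (a v)%:R.
    have -> : (b v)%:R + eps * d = p * ((b v)%:R / p + eps * n%:R).
      by field; rewrite gt_eqF.
    by rewrite ler_pM2l.
  have H2 : p * g%:R <= p * (eps * n%:R / 4) by rewrite ler_pM2l.
  by move: vB H1 H2 (legalR v) d_large; lra.
have qB v : U%:R - 2 * n%:R <= n%:R * (q v)%:R :> R.
  have : ((a v + (U - g))%N%:R : R) <= ((q v).+1 * n)%N%:R.
    by rewrite ler_nat ltnW // ltn_ceil.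
  rewrite natrD natrB // natrM -natr1 => H1.
  have H2 : (g%:R : R) <= n%:R by rewrite ler_nat.
  by move: H1 H2 (ler0n R (a v)); lra.
set be : R := #|B|%:R; set X : R := \sum_(v in B) (h v)%:R.
have sumc (y : R) : \sum_(v in B) y = be * y by rewrite sumr_const mulr_natl.
have X_le : n%:R * X <= be * (L%:R + 1) * n%:R + be * U%:R + kappa * n%:R * n%:R.
  rewrite -(ler_pM2l p_gt0).
  apply: (@le_trans _ _ (be * ((L%:R + 1) * d) + \sum_(v in B) (nbsum G h v)%:R)).
    rewrite -sumc -big_split /X [p * (n%:R * _)]mulrA mulr_sumr.
    apply: ler_sum => v _ /=; have := legalR v; have := bL v.
    have : eps * d <= 1 * d by rewrite ler_wpM2r // ltW.
    by have := d0; lra.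
  have := sum_exceptional B h_le; rewrite ler_norml => /andP[_].
  rewrite -/U -/be natr_sum; lra.
have n_sum : n%:R * (U%:R - X) + be * (U%:R - 2 * n%:R) <=
    n%:R * (\sum_v q v)%N%:R.
  rewrite {1}UR (bigID [in B]) /= -/X [X + _]addrC addrK.
  rewrite natr_sum [\sum_v (q v)%:R](bigID [in B]) /= [leRHS]mulrDr [leLHS]addrC.
  apply: lerD.
    rewrite -sumc mulr_sumr; apply: ler_sum => v _; exact: qB.
  by rewrite ler_wpM2l //; apply: ler_sum => v /good; rewrite ler_nat.
rewrite -(ler_nat R) natrB // -(ler_pM2l n0).
have := exceptional_budget h_le; rewrite -/B -/be => budget.
have g_gt' : eps * n%:R / 4 - 1 <= g%:R by move: g_gt; rewrite -natr1; lra.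
have := ler_wpM2r (ltW n0) (le_trans budget g_gt'); rewrite natrD.
by move: X_le n_sum; lra.
Qed.

Lemma volatile_random_of_complete b c :
  (forall v, (b v)%:R <= L%:R * n%:R :> R) ->
  (forall v, p * (b v)%:R + eps * d <= (c v)%:R) ->
  volatile (complete_graph n) b -> volatile G c.
Proof.
move=> bL cb vb; apply: contrapT => nvc.
pose c' : config n := [ffun v => Num.truncn (p * (b v)%:R + eps * d)].
have c'P v : (c' v)%:R <= p * (b v)%:R + eps * d < (c' v)%:R + 1.
  rewrite ffunE natr1; apply: truncn_itv.
  by rewrite addr_ge0 // mulr_ge0 // ltW.
have /least_stabilizer[x [stab legal _]] : ~ volatile G c'.
  apply: contra_not nvc; apply: leq_volatile => v; rewrite -(ler_nat R).
  by have /andP[/le_trans + _] := c'P v; apply.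
have c'_le v : (c' v <= deg G v * (2 * L).+2)%N.
  rewrite -(ler_nat R) natrM.
  have -> : ((2 * L).+2%:R : R) = 2 * L%:R + 2.
    by rewrite -[(2 * L).+2]addn2 natrD natrM.
  rewrite mulrC; apply: (@le_trans _ _ ((2 * L%:R + 2) * (99 / 100 * d))); last first.
    by apply: ler_wpM2l (deg_lower v); rewrite addr_ge0 // mulr_ge0.
  have /andP[+ _] := c'P v; move/le_trans; apply.
  have H1 : p * (b v)%:R <= p * (L%:R * n%:R) by rewrite ler_pM2l.
  have H2 : eps * d <= 1 * d by rewrite ler_wpM2r // ltW.
  have H3 : 0 <= L%:R * d by rewrite mulr_ge0 // ltW.
  by move: H1 H2 H3 d0; lra.
have [w|w|m [m_le hH]] := @bounded_of_legal x.
- apply: leq_trans (leq_addl (c' w) _) _; apply: leq_trans (ltnW (stab w)) _.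
  by rewrite leq_mul2l -addn1 leq_add2l orbT.
- by apply: leq_trans (legal w) _; rewrite addnC leq_add2l.
pose h v := (x v - m)%N.
have xE v : (x v = h v + m)%N by rewrite /h subnK.
set U := (\sum_v h v)%N.
have stab_h v : (c' v + nbsum G h v <= deg G v * (h v).+1)%N.
  rewrite -(leq_add2r (deg G v * m)) -mulnDr addSn -xE.
  apply: leq_trans (ltnW (stab v)); rewrite -addnA leq_add2l.
  by rewrite -nbsum_cst -nbsumD; apply: leq_nbsum => w; rewrite xE.
pose g := Num.truncn (eps * n%:R / 4).
have /andP[g_le g_gt] : g%:R <= eps * n%:R / 4 < g.+1%:R.
  by apply: truncn_itv; rewrite divr_ge0 // mulr_ge0 // ltW.
have g_le_n : (g%:R : R) <= n%:R.
  apply: le_trans g_le _.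
  have : eps * n%:R <= 1 * n%:R by rewrite ler_wpM2r.
  by have := n0; lra.
have g_gt0 : (0 < g)%N.
  by rewrite -(ltr_nat R); move: g_gt n_large; rewrite -(natr1 g); lra.
pose q v := ((b v + (U + g)) %/ n)%N.
have main : (U + g <= \sum_v q v)%N.
  have := (volatile_completeP b).1 vb (U + g).-1.
  by rewrite prednK // addn_gt0 g_gt0 orbT.
set B := exceptional h; have h_lt v : (h v < spread)%N := hH v.
have h_le v : (h v <= spread)%N := ltnW (hH v).
have UR : (U%:R : R) = \sum_v (h v)%:R by rewrite natr_sum.
have stabR v : (c' v)%:R + (nbsum G h v)%:R <= d * (h v)%:R + d + eps / 8 * d.
  have : ((c' v + nbsum G h v)%N%:R : R) <= (deg G v * (h v).+1)%N%:R.
    by rewrite ler_nat.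
  rewrite natrM natrD => /le_trans; apply.
  apply: (@le_trans _ _ ((1 + eta) * d * (h v).+1%:R)).
    by rewrite ler_wpM2r //; have /andP[] := deg_bounds prG v.
  by have := @eta_mul_le (fun v => (h v).+1) v (h_lt v); rewrite -natr1; lra.
have good v : v \notin B -> (q v <= h v)%N.
  rewrite inE -leNgt -/U ler_norml => /andP[vB _].
  rewrite -ltnS ltn_divLR // -(ltr_nat R) natrM natrD natrD -natr1.
  rewrite -(ltr_pM2l p_gt0).
  have H2 : p * g%:R <= p * (eps * n%:R / 4) by rewrite ler_pM2l.
  by have /andP[_] := c'P v; move: vB H2 (stabR v) d_large; lra.
have qB v : n%:R * (q v)%:R <= (L%:R + 1) * n%:R + U%:R :> R.
  have : ((q v * n)%N%:R : R) <= (b v + (U + g))%N%:R by rewrite ler_nat leq_divM.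
  by rewrite natrM natrD natrD; move: (bL v) g_le_n; lra.
set be : R := #|B|%:R; set X : R := \sum_(v in B) (h v)%:R.
have sumc (y : R) : \sum_(v in B) y = be * y by rewrite sumr_const mulr_natl.
have X_ge : be * U%:R - kappa * n%:R * n%:R <= n%:R * X + 2 * be * n%:R.
  rewrite -(ler_pM2l p_gt0).
  have H : \sum_(v in B) (nbsum G h v)%:R <= d * X + be * (2 * d).
    rewrite -sumc /X mulr_sumr -big_split /=; apply: ler_sum => v _.
    have : eps * d <= 1 * d by rewrite ler_wpM2r // ltW.
    by move: (stabR v) d0 (ler0n R (c' v)); lra.
  have := sum_exceptional B h_le; rewrite ler_norml => /andP[+ _].
  by move: H; rewrite -/U -/be natr_sum; lra.
have n_sum : n%:R * (\sum_v q v)%N%:R <=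
    n%:R * (U%:R - X) + be * ((L%:R + 1) * n%:R + U%:R).
  rewrite {1}UR [\sum_v (h v)%:R](bigID [in B]) /= -/X [X + _]addrC addrK.
  rewrite natr_sum (bigID [in B]) /= [leLHS]mulrDr [leRHS]addrC.
  apply: lerD.
    rewrite -sumc mulr_sumr; apply: ler_sum => v _; exact: qB.
  by rewrite ler_wpM2l //; apply: ler_sum => v /good; rewrite ler_nat.
have : n%:R * (U + g)%N%:R <= n%:R * (\sum_v q v)%N%:R :> R.
  by rewrite ler_wpM2l // ler_nat.
have g_gt' : eps * n%:R / 4 - 1 < g%:R by move: g_gt; rewrite -(natr1 g); lra.
have := le_lt_trans (exceptional_budget h_le) g_gt'; rewrite -/B -/be.
have lt_mul (y z : R) : y < z -> y * n%:R < z * n%:R by rewrite ltr_pM2r.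
by move=> /lt_mul; move: X_ge n_sum; rewrite !natrD; lra.
Qed.

End Transfer.

Section Comparison.
Context (R : realType) (n : nat).

Lemma chips_volatile_complete (a : config n) : volatile (complete_graph n) a ->
  (n * n./2 <= 2 * chips a)%N.
Proof.
move=> /volatile_completeP va.
have [->|h_gt0] := posnP n./2; first by rewrite muln0.
have := va n./2.-1; rewrite prednK // => le_sum.
apply: (@leq_trans (n * \sum_v ((a v + n./2) %/ n))).
  by rewrite leq_mul2l le_sum orbT.
rewrite !big_distrr /=; apply: leq_sum => v _.
have := odd_double_half n; have := leq_divM (a v + n./2) n.
rewrite [(n * _)%N]mulnC -muln2.
case: ((a v + n./2) %/ n)%N => [|q]; first by rewrite mul0n.
by rewrite mulSn; lia.
Qed.

Lemma toppling_complete_ge : (8 <= n)%N ->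
  n%:R * n%:R / 16 <= toppling_number R (complete_graph n).
Proof.
move=> n8; have v0 : 'I_n by exists 0%N; lia.
have [k wk le_t] := toppling_number_ge R (complete_graph n) v0.
have [|y sy /chips_volatile_complete] :=
    @min_wins_reply _ (complete_graph n) (nseq k v0) 0 (cfg [::]).
  by rewrite size_nseq addn0.
rewrite !chipsD !chips_cfg sy size_nseq add0n addnn => le_k.
apply: le_trans le_t; rewrite lerBrDr.
have : (n * n + 16 <= 16 * k.*2)%N.
  have := odd_double_half n; have : (odd n <= 1)%N by case: odd.
  by rewrite -!muln2 in le_k *; nia.
by rewrite -(ler_nat R) natrD !natrM; lra.
Qed.

Variables (G1 G2 : sgraph n) (d1 d2 D eps : R) (N : nat) (v0 : 'I_n).
Hypotheses (d1_gt0 : 0 < d1) (d2_gt0 : 0 < d2) (D_gt0 : 0 < D).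
Hypotheses (D1 : D <= d1) (D2 : D <= d2) (eps_gt0 : 0 < eps) (N_gt0 : (0 < N)%N).
Hypothesis deg2 : (\sum_v deg G2 v)%N%:R <= 3 / 2 * d2 * n%:R.

Hypothesis transfer : forall b c : config n,
  (forall v, (b v)%:R <= N%:R * scaled_degree G1 G2 (d2 / d1) v) ->
  (forall v, (b v)%:R * (d1 / d2) + eps * d1 <= (c v)%:R) ->
  volatile G2 b -> volatile G1 c.

Lemma toppling_comparison :
  toppling_number R G1 <= toppling_number R G2 * (d1 / d2) +
    d1 * n%:R * (3 / N%:R + 2 * eps + 20 * (N%:R + 1) / D).
Proof.
have n_gt0 : 0 < n%:R :> R by rewrite ltr0n (leq_ltn_trans _ (ltn_ord v0)).
have n_ge1 : 1 <= n%:R :> R by rewrite ler1n (leq_ltn_trans _ (ltn_ord v0)).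
have N0 : 0 < N%:R :> R by rewrite ltr0n.
have N1 : 1 <= N%:R :> R by rewrite ler1n.
set s : R := d1 / d2; have s_gt0 : 0 < s by rewrite divr_gt0.
have sV : (d2 / d1)^-1 = s by rewrite invf_div.
have [k wk le_t] := toppling_number_ge R G2 v0.
pose j2 := (k %/ N).+1.
have le_j2 : j2%:R <= k%:R / N%:R + 1 :> R.
  rewrite -natr1 lerD2r ler_pdivlMr // -natrM ler_nat; exact: leq_divM.
pose z : R := j2%:R * s + n%:R + n%:R * s.
have z_ge0 : 0 <= z by rewrite !addr_ge0 // mulr_ge0 // ltW.
pose j1 := (Num.truncn z).+1.
have /andP[z_le z_lt] := truncn_itv z_ge0.
have ed_ge0 : 0 <= eps * d1 by rewrite mulr_ge0 // ltW.
pose e := (Num.truncn (eps * d1)).+1.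
have /andP[e_le e_lt] := truncn_itv ed_ge0.
have wG1 : min_wins G1 (N * j1 + (j1 + n * e)) (cfg [::]).
  apply: (@simulation R n G1 G2 (d2 / d1) j1 j2 N e v0) => //.
  - by rewrite divr_gt0.
  - have -> : j2%:R + n%:R = d2 / d1 * (j2%:R * s + n%:R * s) :> R.
      by rewrite /s; field; rewrite !gt_eqF.
    rewrite ler_pM2l ?divr_gt0 //; apply: le_trans (ltW z_lt).
    by rewrite /z; lra.
  - rewrite sV; apply: le_trans (ltW z_lt); rewrite /z.
    by have : 0 <= n%:R * s by [rewrite mulr_ge0 // ltW]; lra.
  - move=> b c bN bc; apply: transfer => // v; apply: le_trans (bc v).
    by rewrite sV lerD2l ltW.
  have : (k <= N * j2)%N by rewrite mulnC ltnW // ltn_ceil.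
  by move=> /subnK <-; exact: min_wins_addl.
have := toppling_number_le R v0 wG1; move/le_trans; apply.
rewrite -muln2 natrM natrD natrD !natrM.
have z_le' : j1%:R <= z + 1 by rewrite -natr1 lerD2r.
have e_le' : e%:R <= eps * d1 + 1 by rewrite -natr1 lerD2r.
have t_le : toppling_number R G2 <= 3 * d2 * n%:R.
  apply: le_trans (toppling_number_le R v0 (min_wins_sum_deg G2 v0)) _.
  by rewrite -muln2 natrM; move: deg2; lra.
set t : R := toppling_number R G2 in le_t t_le *.
set x : R := d1 * n%:R / D.
have H1 : n%:R <= x.
  by rewrite /x ler_pdivlMr // mulrC ler_wpM2r.
have H2 : s * n%:R <= x.
  rewrite /x /s mulrAC; apply: ler_wpM2l; first by rewrite mulr_ge0 // ltW.
  by rewrite lef_pV2 ?posrE.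
have H3 : s <= s * n%:R by rewrite ler_peMr // ltW.
have H4 : t * s <= 3 * (d1 * n%:R).
  have -> : 3 * (d1 * n%:R) = 3 * d2 * n%:R * s.
    by rewrite /s; field; rewrite gt_eqF.
  by rewrite ler_wpM2r // ltW.
set w : R := k%:R * s / N%:R.
have Nw : N%:R * w = k%:R * s by rewrite /w; field; rewrite gt_eqF.
have le_ks : 2 * (k%:R * s) <= t * s + s.
  have : (k.*2%:R - 1) * s <= t * s by rewrite ler_wpM2r // ltW.
  by rewrite -muln2 natrM; lra.
have x_ge0 : 0 <= x by apply: le_trans H1; exact: ltW.
have le_w : 2 * w <= 3 * (d1 * n%:R) / N%:R + x.
  apply: (@le_trans _ _ ((3 * (d1 * n%:R) + x) / N%:R)).
    have -> : 2 * w = 2 * (k%:R * s) / N%:R by rewrite /w; ring.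
    by rewrite ler_pM2r ?invr_gt0 //; lra.
  by rewrite mulrDl lerD2l ler_pdivrMr // ler_peMr.
have j2s : j2%:R * s <= w + s.
  have -> : w + s = (k%:R / N%:R + 1) * s by rewrite /w; ring.
  by rewrite ler_wpM2r // ltW.
have le_j1 : j1%:R <= w + 4 * x by move: z_le'; rewrite /z; lra.
have Nj1 : N%:R * j1%:R <= k%:R * s + 4 * (N%:R * x).
  have : N%:R * j1%:R <= N%:R * (w + 4 * x) by rewrite ler_wpM2l.
  by lra.
have ne : n%:R * e%:R <= n%:R * (eps * d1 + 1) by rewrite ler_wpM2l.
have -> : d1 * n%:R * (3 / N%:R + 2 * eps + 20 * (N%:R + 1) / D) =
    3 * (d1 * n%:R) / N%:R + 2 * (eps * d1 * n%:R) + 20 * (N%:R * x + x).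
  by rewrite /x; ring.
have Nx : 0 <= N%:R * x by rewrite mulr_ge0.
by clear -H1 H2 H3 le_ks le_w le_j1 Nj1 ne Nx x_ge0; lra.
Qed.

End Comparison.

Lemma toppling_pseudorandom (R : realType) (n : nat) (G : sgraph n)
    (p eta lam e : R) (N k : nat) :
  pseudorandom G p eta lam -> 0 < p -> p <= 1 -> (8 <= n)%N ->
  0 <= eta -> eta <= 1 / 100 -> 0 < lam -> 0 < e -> e <= 1 -> (0 < N)%N ->
  n%:R <= (p * n%:R / (5 * lam)) ^+ k ->
  (spread (3 * N) k)%:R * eta * (100 * (3 * N + 4)%:R) <= (e / 128) ^+ 2 ->
  192 / N%:R <= e -> 10 * (128 * (N%:R + 1)) <= e * (p * n%:R) ->
  `| toppling_number R G - p * toppling_number R (complete_graph n) |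
      <= e * (p * toppling_number R (complete_graph n)).
Proof.
move=> prG p0 p1 n8 eta0 eta1 lam0 e0 e1 N0 kn small eN ed.
have n_gt0 : (0 < n)%N by exact: leq_trans n8.
pose v0 := Ordinal n_gt0; set d := p * n%:R in kn ed *.
have n0 : 0 < n%:R :> R by rewrite ltr0n.
have d0 : 0 < d by rewrite mulr_gt0.
have dn : d <= n%:R by rewrite /d ler_piMl // ltW.
have NR : 0 < N%:R :> R by rewrite ltr0n.
have NR1 : 1 <= N%:R :> R by rewrite ler1n.
have eps0 : 0 < e / 128 by rewrite divr_gt0.
have eps1 : e / 128 <= 1 by move: e1; clear; lra.
have d_large : 8 <= e / 128 * d by move: ed NR1; clear; lra.
have n_large : 8 <= e / 128 * n%:R.
  by apply: le_trans d_large _; rewrite ler_pM2l.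
have L0 : (0 < 3 * N)%N by rewrite muln_gt0.
have LE : ((3 * N)%N%:R : R) = 3 * N%:R by rewrite natrM.
have degG v : (deg G v)%:R <= 101 / 100 * d.
  have /andP[_] := deg_bounds prG v; move/le_trans; apply.
  by rewrite ler_pM2r //; move: eta1; clear; lra.
have degK v : (deg (complete_graph n) v)%:R <= n%:R :> R.
  by rewrite ler_nat -[leqRHS](deg_complete v).
have tol : 3 / N%:R + 2 * (e / 128) + 20 * (N%:R + 1) / d <= 3 / 64 * e.
  have : 20 * (N%:R + 1) / d <= e / 64.
    by rewrite ler_pdivrMr //; move: ed; clear; lra.
  have -> : 3 / N%:R = 192 / N%:R / 64 :> R by field; rewrite gt_eqF.
  by move: eN; clear; lra.
have GK : toppling_number R G <=
    toppling_number R (complete_graph n) * (d / n%:R) + d * n%:R * (3 / 64 * e).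
  apply: le_trans (@toppling_comparison _ _ G (complete_graph n) d n%:R d
    (e / 128) N v0 _ _ _ _ _ _ _ _ _) _ => //.
  - rewrite natr_sum; apply: le_trans (_ : \sum_(v : 'I_n) n%:R <= _).
      by apply: ler_sum => v _.
    rewrite sumr_const card_ord -mulr_natr.
    have : 0 < n%:R * n%:R :> R by rewrite mulr_gt0.
    by clear; lra.
  - move=> b c bN bc.
    apply: (@volatile_random_of_complete R n G p eta lam _ _ _ _ _ _ (3 * N) k
      (e / 128)) => // v.
      apply: le_trans (bN v) _; rewrite LE [3 * _]mulrC -mulrA ler_pM2l //.
      rewrite /scaled_degree.
      have : n%:R / d * (deg G v)%:R <= n%:R / d * (101 / 100 * d).
        by rewrite ler_pM2l // divr_gt0.
      have -> : n%:R / d * (101 / 100 * d) = 101 / 100 * n%:R.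
        by field; rewrite gt_eqF.
      by move: (degK v) n0; clear; lra.
    by apply: le_trans (bc v); rewrite /d mulfK ?gt_eqF // mulrC.
  by rewrite lerD2l ler_pM2l // mulr_gt0.
have KG : toppling_number R (complete_graph n) <=
    toppling_number R G * (n%:R / d) + n%:R * n%:R * (3 / 64 * e).
  apply: le_trans (@toppling_comparison _ _ (complete_graph n) G n%:R d d
    (e / 128) N v0 _ _ _ _ _ _ _ _ _) _ => //.
  - rewrite natr_sum; apply: le_trans (_ : \sum_(v : 'I_n) 101 / 100 * d <= _).
      by apply: ler_sum => v _.
    rewrite sumr_const card_ord -mulr_natr.
    have : 0 < d * n%:R :> R by rewrite mulr_gt0.
    by clear; lra.
  - move=> b c bN bc.
    apply: (@volatile_complete_of_random R n G p eta lam _ _ _ _ _ _ (3 * N) k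
      (e / 128) _ _ _ _ _ _ _ c b) => // v.
      apply: le_trans (bN v) _; rewrite LE -/d.
      have -> : 3 * N%:R * d = N%:R * (3 * d) by ring.
      rewrite ler_pM2l //.
      rewrite /scaled_degree.
      have : d / n%:R * (deg (complete_graph n) v)%:R <= d / n%:R * n%:R.
        by rewrite ler_pM2l // divr_gt0.
      rewrite divfK ?gt_eqF //.
      by move: (degG v) d0; clear; lra.
    apply: le_trans (bc v); rewrite lerD2r ler_wpM2l //.
    by rewrite /d invfM mulrCA divff ?mulr1 ?gt_eqF.
  by rewrite lerD2l ler_pM2l // mulr_gt0.
have := toppling_complete_ge R n8.
set tG := toppling_number R G in GK KG *.
set tK := toppling_number R (complete_graph n) in GK KG * => tK_ge.
have pE : d / n%:R = p by rewrite /d mulfK // gt_eqF.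
have KG' : p * tK <= tG + d * n%:R * (3 / 64 * e).
  have -> : tG + d * n%:R * (3 / 64 * e) =
      p * (tG * (n%:R / d) + n%:R * n%:R * (3 / 64 * e)).
    by rewrite /d; field; rewrite !gt_eqF.
  by rewrite ler_pM2l.
have GK' : tG <= p * tK + d * n%:R * (3 / 64 * e) by rewrite -pE mulrC in GK *.
have lower : d * n%:R * (3 / 64 * e) <= e * (p * tK).
  apply: (@le_trans _ _ (e * (p * (n%:R * n%:R / 16)))); last first.
    by rewrite ler_pM2l // ler_pM2l.
  have : 0 <= e * (d * n%:R) by rewrite !mulr_ge0 // ltW.
  by rewrite /d; clear; lra.
by rewrite ler_norml; move: KG' GK' lower; clear => *; apply/andP; split; lra.
Qed.

Section RandomGraph.
Context (R : realType) (n : nat).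
Implicit Types (G : sgraph n) (S T e : {set 'I_n}) (v w : 'I_n).

Lemma sum_sgraph_prod (F H : {set 'I_n} -> R) :
  \sum_(G : sgraph n) \prod_(e : {set 'I_n} | #|e| == 2%N)
    (if e \in edges G then F e else H e)
  = \prod_(e : {set 'I_n} | #|e| == 2%N) (F e + H e).
Proof.
pose F' e := if #|e| == 2%N then F e else 0.
pose H' e := if #|e| == 2%N then H e else 1.
have -> : \prod_(e : {set 'I_n} | #|e| == 2%N) (F e + H e) = \prod_e (F' e + H' e).
  rewrite [LHS]big_mkcond; apply: eq_bigr => e _.
  by rewrite /F' /H'; case: ifP; rewrite ?add0r.
pose val2 (J : {set {set 'I_n}}) := [forall e in J, #|e| == 2%N].
rewrite bigA_distr (bigID val2) /= [X in _ = _ + X]big1 ?addr0; last first.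
  move=> J /forall_inPn[e eJ /negbTE e2].
  by rewrite (bigD1 e) //= eJ /F' e2 mul0r.
transitivity (\sum_(G : sgraph n) \prod_e (if e \in val G then F' e else H' e)).
  apply: eq_bigr => G _; rewrite [LHS]big_mkcond; apply: eq_bigr => e _.
  rewrite /F' /H' /edges; case: ifP => // e2; case: ifP => // eG.
  by have /forall_inP/(_ _ eG) := valP G; rewrite e2.
rewrite -(big_sub [pred J | val2 J]
  (fun J : {set {set 'I_n}} => \prod_e (if e \in J then F' e else H' e))).
by apply: eq_bigl => J; rewrite !inE.
Qed.

Lemma sum_expr_card (x : R) : \sum_(S : {set 'I_n}) x ^+ #|S| = (1 + x) ^+ n.
Proof.
transitivity (\prod_(v : 'I_n) (x + 1)); last first.
  by rewrite prodr_const card_ord addrC.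
rewrite bigA_distr; apply: eq_bigr => S _.
by rewrite -prodr_const big_mkcond.
Qed.

Lemma edge_count_setT G v : edge_count G [set v] [set: 'I_n] = deg G v.
Proof.
rewrite /edge_count big_set1 deg_sum; by apply: eq_bigl => w; rewrite inE.
Qed.

Definition edge_weight S T e : nat :=
  (\sum_(v in S) \sum_(w in T) (e == [set v; w]%SET))%N.

Lemma edge_countE G S T :
  edge_count G S T =
  (\sum_(e : {set 'I_n} | #|e| == 2%N)
     if e \in edges G then edge_weight S T e else 0)%N.
Proof.
have adjE v w : adj G v w =
    (\sum_(e : {set 'I_n} | #|e| == 2%N)
       (e \in edges G) * (e == [set v; w]%SET))%N :> nat.
  case vw : (adj G v w).
    have c2 : #|[set v; w]%SET| == 2%N by have /forall_inP/(_ _ vw) := valP G.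
    rewrite (bigD1 [set v; w]%SET) //= eqxx; move: vw; rewrite /adj /= => ->.
    by rewrite big1 // => e /andP[_ /negbTE ->]; rewrite muln0.
  rewrite big1 // => e _; case: eqP => [->|_]; last by rewrite muln0.
  by move: vw; rewrite /adj /= => ->.
rewrite /edge_count; under eq_bigr => v _ do under eq_bigr => w _ do rewrite adjE.
under eq_bigr => v _ do rewrite exchange_big.
rewrite exchange_big /=; apply: eq_bigr => e _; rewrite /edge_weight.
case: ifP => eG; last by rewrite big1 // => v _; rewrite big1.
by apply: eq_bigr => v _; apply: eq_bigr => w _; rewrite mul1n.
Qed.

Lemma edge_weight_le2 S T e : #|e| == 2%N -> (edge_weight S T e <= 2)%N.
Proof.
move=> /eqP e2; apply: (@leq_trans #|e|); last by rewrite e2.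
rewrite -sum1_card /edge_weight big_mkcond.
rewrite [leqRHS]big_mkcond; apply: leq_sum => v _; case: ifP => // _.
have [w0 /andP[w0T /eqP ew0]|none] := pickP [pred w in T | e == [set v; w]%SET].
  have -> : v \in e by rewrite ew0 set21.
  rewrite (bigD1 w0) //= ew0 eqxx big1 // => w /andP[_ ww0].
  case: eqP => // E; have : w \in [set v; w0]%SET by rewrite E set22.
  rewrite !inE (negbTE ww0) orbF => /eqP wv.
  by move: e2; rewrite ew0 E wv finset.setUid cards1.
rewrite big1 // => w wT; have := none w; rewrite /= wT /= => ->; by [].
Qed.

Lemma sum_edge_weight S T : exists2 m : nat,
  (\sum_(e : {set 'I_n} | #|e| == 2%N) edge_weight S T e + m = #|S| * #|T|)%N &
  (m <= #|S|)%N.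
Proof.
exists (\sum_(v in S) \sum_(w in T) (v == w))%N; last first.
  rewrite -sum1_card; apply: leq_sum => v _.
  have [vT|vT] := boolP (v \in T).
    rewrite (bigD1 v) //= eqxx big1 // => w /andP[_ /negbTE].
    by rewrite eq_sym => ->.
  by rewrite big1 // => w wT; case: eqVneq wT vT => // -> ->.
rewrite -sum_nat_const exchange_big /=.
rewrite -big_split /=; apply: eq_bigr => v _.
rewrite exchange_big /= -big_split /= -sum1_card; apply: eq_bigr => w _.
have [->|vw] := eqVneq v w.
  rewrite big1 // => e /eqP e2; case: eqP => // ew.
  by move: e2; rewrite ew finset.setUid cards1.
rewrite (bigD1 [set v; w]%SET) /= ?cards2 ?vw // eqxx big1 // => e.
by move=> /andP[_ /negbTE ->].
Qed.

Variable p : R.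
Hypotheses (p_ge0 : 0 <= p) (p_le1 : p <= 1).

Definition gnp_mean (f : sgraph n -> R) : R := \sum_G gnp_weight p G * f G.

Lemma gnp_weight_ge0 G : 0 <= gnp_weight p G.
Proof.
by apply: prodr_ge0 => e _; case: ifP; rewrite ?subr_ge0.
Qed.

Lemma gnp_meanD (f g : sgraph n -> R) :
  gnp_mean (fun G => f G + g G) = gnp_mean f + gnp_mean g.
Proof.
by rewrite /gnp_mean -big_split; apply: eq_bigr => G _; rewrite /= mulrDr.
Qed.

Lemma gnp_mean_sum (I : finType) (P : pred I) (f : I -> sgraph n -> R) :
  gnp_mean (fun G => \sum_(i | P i) f i G) = \sum_(i | P i) gnp_mean (f i).
Proof.
rewrite /gnp_mean exchange_big; apply: eq_bigr => G _.
by rewrite mulr_sumr.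
Qed.

Lemma gnp_prob_ge (A : pred (sgraph n)) (f : sgraph n -> R) :
  (forall G, 0 <= f G) -> (forall G, ~~ A G -> 1 <= f G) ->
  1 - gnp_mean f <= gnp_prob p A.
Proof.
move=> f0 f1; rewrite lerBlDr -(gnp_prob_setT n p) /gnp_prob (bigID A) /=.
rewrite lerD2l /gnp_mean [leRHS](bigID A) /= -[leLHS]add0r lerD //.
  by apply: sumr_ge0 => G _; rewrite mulr_ge0 ?gnp_weight_ge0.
by apply: ler_sum => G /f1 fG; rewrite ler_peMr ?gnp_weight_ge0.
Qed.

Lemma gnp_prob_le1 (A : pred (sgraph n)) : gnp_prob p A <= 1.
Proof.
rewrite -(gnp_prob_setT n p) [leRHS](bigID A) /= lerDl.
by apply: sumr_ge0 => G _; exact: gnp_weight_ge0.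
Qed.

Lemma le_gnp_prob (A B : pred (sgraph n)) :
  (forall G, A G -> B G) -> gnp_prob p A <= gnp_prob p B.
Proof.
move=> AB; rewrite /gnp_prob [leRHS](bigID A) /=.
rewrite [X in _ <= X + _](eq_bigl A) => [|G]; last first.
  by apply/andP/idP => [[]//|AG]; rewrite AB.
by rewrite lerDl; apply: sumr_ge0 => G _; exact: gnp_weight_ge0.
Qed.

Lemma expR_le_quadratic (x : R) : x <= 1 / 2 -> expR x <= 1 + x + 2 * x ^+ 2.
Proof.
move=> x2; have x1 : 0 < 1 - x by lra.
have e_le : expR x <= (1 - x)^-1.
  rewrite -[x in expR x]opprK expRN lef_pV2 ?posrE ?expR_gt0 //.
  exact: expR_ge1Dx.
apply: le_trans e_le _; rewrite -div1r ler_pdivrMr //.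
have : 0 <= x ^+ 2 * (1 - 2 * x) by rewrite mulr_ge0 ?sqr_ge0 //; lra.
by nra.
Qed.

Local Notation mean_edges S T :=
  (p * (\sum_(e : {set 'I_n} | #|e| == 2%N) edge_weight S T e)%N%:R).

Definition edge_tail (th y : R) S T G : R :=
  expR (th * ((edge_count G S T)%:R - mean_edges S T)
        - 4 * th ^+ 2 * (p * #|S|%:R * #|T|%:R) - y).

Lemma mean_edge_tail th y S T : `|th| <= 1 / 4 ->
  gnp_mean (edge_tail th y S T) <= expR (- y).
Proof.
rewrite ler_norml => /andP[th1 th2].
pose W := (\sum_(e : {set 'I_n} | #|e| == 2%N) edge_weight S T e)%N.
have [m W_m _] := sum_edge_weight S T.
have W_le : (W%:R : R) <= #|S|%:R * #|T|%:R by rewrite -natrM ler_nat -W_m leq_addr.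
pose K := expR (- (th * (p * W%:R)) - 4 * th ^+ 2 * (p * #|S|%:R * #|T|%:R) - y).
have -> : gnp_mean (edge_tail th y S T) =
    K * \prod_(e : {set 'I_n} | #|e| == 2%N)
          (p * expR (th * (edge_weight S T e)%:R) + (1 - p)).
  rewrite -sum_sgraph_prod mulr_sumr; apply: eq_bigr => G _.
  have -> : edge_tail th y S T G = K * expR (th * (edge_count G S T)%:R).
    by rewrite -expRD; congr expR; rewrite -/W; ring.
  rewrite mulrCA; congr (_ * _); rewrite edge_countE natr_sum mulr_sumr expR_sum.
  rewrite /gnp_weight -big_split; apply: eq_bigr => e _ /=.
  by case: ifP => _; rewrite ?mulr0 ?expR0 ?mulr1.
apply: (@le_trans _ _ (K * \prod_(e : {set 'I_n} | #|e| == 2%N)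
    expR ((p * th + 4 * p * th ^+ 2) * (edge_weight S T e)%:R))).
  rewrite ler_wpM2l ?expR_ge0 //; apply: ler_prod => e e2.
  have le2 : ((edge_weight S T e)%:R : R) <= 2 by rewrite ler_nat edge_weight_le2.
  have ge0 : 0 <= (edge_weight S T e)%:R :> R by [].
  move: le2 ge0; set x : R := (edge_weight _ _ _)%:R => le2 ge0.
  rewrite addr_ge0 ?subr_ge0 ?mulr_ge0 ?expR_ge0 //=.
  apply: le_trans (expR_ge1Dx _).
  have : expR (th * x) <= 1 + th * x + 2 * (th * x) ^+ 2.
    apply: expR_le_quadratic.
    by apply: (@le_trans _ _ (1 / 4 * x)); [rewrite ler_wpM2r | lra].
  have : (th * x) ^+ 2 <= th ^+ 2 * (2 * x).
    by rewrite exprMn ler_wpM2l ?sqr_ge0 // expr2 ler_wpM2r.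
  move=> H1 H2.
  have : p * expR (th * x) <= p * (1 + th * x + 4 * th ^+ 2 * x).
    by rewrite ler_wpM2l //; lra.
  by lra.
rewrite -expR_sum -mulr_sumr -natr_sum -/W -expRD ler_expR.
have : 4 * p * th ^+ 2 * W%:R <= 4 * p * th ^+ 2 * (#|S|%:R * #|T|%:R).
  by rewrite ler_wpM2l // mulr_ge0 ?sqr_ge0 ?mulr_ge0.
by lra.
Qed.

Lemma ler_sum_term (I : finType) (P : pred I) (f : I -> R) i :
  P i -> (forall j, 0 <= f j) -> f i <= \sum_(j | P j) f j.
Proof. by move=> Pi f0; rewrite (bigD1 i) //= lerDl sumr_ge0. Qed.

Lemma edge_tail_lt1 th y S T G : edge_tail th y S T G < 1 ->
  th * ((edge_count G S T)%:R - mean_edges S T) <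
  4 * th ^+ 2 * (p * #|S|%:R * #|T|%:R) + y.
Proof.
by rewrite /edge_tail -[X in _ < X -> _]expR0 ltr_expR; lra.
Qed.

Lemma mean_edges_bounds S T :
  p * #|S|%:R * #|T|%:R - p * #|S|%:R <= mean_edges S T
    <= p * #|S|%:R * #|T|%:R.
Proof.
have [m W_m mS] := sum_edge_weight S T.
move: W_m; set W := (\sum_(e : {set 'I_n} | _) _)%N => W_m.
have WE : (W%:R : R) + m%:R = #|S|%:R * #|T|%:R by rewrite -natrD W_m natrM.
have m0 : 0 <= m%:R :> R by [].
have mS' : (m%:R : R) <= #|S|%:R by rewrite ler_nat.
have -> : p * #|S|%:R * #|T|%:R = p * W%:R + p * m%:R.
  by rewrite -mulrDr WE mulrA.
have : p * m%:R <= p * #|S|%:R by rewrite ler_wpM2l.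
have : 0 <= p * m%:R by rewrite mulr_ge0.
by move=> H1 H2; apply/andP; split; lra.
Qed.

Local Notation d := (p * n%:R).
Local Notation l := (ln n%:R : R).

Hypotheses (n_large : (16 <= n)%N) (d_large : 4 <= Num.sqrt d).

Let th : R := (Num.sqrt d)^-1.

Definition deviation G : R :=
  \sum_(S : {set 'I_n} | (0 < #|S|)%N) \sum_(T : {set 'I_n} | (0 < #|T|)%N)
    edge_tail (1 / 4) (2 * l * (#|S|%:R + #|T|%:R)) S T G +
  \sum_(S : {set 'I_n}) \sum_(T : {set 'I_n})
    (edge_tail th (4 * n%:R) S T G + edge_tail (- th) (4 * n%:R) S T G) +
  \sum_(v : 'I_n) (edge_tail th (2 * l) [set v] [set: 'I_n] G +
                   edge_tail (- th) (2 * l) [set v] [set: 'I_n] G).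

Let n0 : 0 < n%:R :> R.
Proof. by rewrite ltr0n; apply: leq_trans n_large. Qed.

Let n16 : 16 <= n%:R :> R.
Proof. by rewrite ler_nat. Qed.

Let l_ge0 : 0 <= l.
Proof. by apply: ln_ge0; apply: le_trans n16; lra. Qed.

Let expRNl : expR (- l) = n%:R^-1.
Proof. by rewrite expRN lnK. Qed.

Lemma expR1_le4 : expR (1 : R) <= 4.
Proof.
have half : expR (1 / 2 : R) <= 2 by apply: le_trans (expR_le_quadratic _) _; lra.
have -> : (1 : R) = 1 / 2 + 1 / 2 by field.
rewrite expRD; apply: (@le_trans _ _ (2 * 2)); last by lra.
by rewrite ler_pM ?expR_ge0.
Qed.

Lemma mean_deviation : gnp_mean deviation <= 4 / n%:R.
Proof.
have th_le : `|th| <= 1 / 4.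
  rewrite /th ger0_norm ?invr_ge0 ?sqrtr_ge0 // -[1 / 4]invf_div divr1.
  by rewrite lef_pV2 ?posrE //; apply: lt_le_trans d_large.
have thN_le : `|- th| <= 1 / 4 by rewrite normrN.
have le14 : `|1 / 4 : R| <= 1 / 4 by rewrite ger0_norm.
rewrite !gnp_meanD.
have -> : 4 / n%:R = 1 / n%:R + 1 / n%:R + 2 / n%:R :> R by field; rewrite gt_eqF.
apply: lerD; [apply: lerD|].
- apply: (@le_trans _ _ (\sum_(S : {set 'I_n}) \sum_(T : {set 'I_n})
    (n%:R^-1) ^+ 2 * ((n%:R^-1) ^+ #|S| * (n%:R^-1) ^+ #|T|))).
    rewrite gnp_mean_sum big_mkcond; apply: ler_sum => S _.
    have ge0 (T : {set 'I_n}) :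
        0 <= (n%:R^-1) ^+ 2 * ((n%:R^-1) ^+ #|S| * (n%:R^-1) ^+ #|T|) :> R.
      by rewrite !mulr_ge0 ?exprn_ge0 ?invr_ge0.
    case: ifP => S0; last by rewrite sumr_ge0.
    rewrite gnp_mean_sum big_mkcond; apply: ler_sum => T _.
    case: ifP => T0 //; apply: le_trans (mean_edge_tail _ _ _ le14) _.
    rewrite -expRNl -!expRM_natr -!expRD ler_expR.
    have s1 : 1 <= #|S|%:R :> R by rewrite ler1n.
    have t1 : 1 <= #|T|%:R :> R by rewrite ler1n.
    have : l * 2 <= l * (#|S|%:R + #|T|%:R) by rewrite ler_wpM2l //; lra.
    by lra.
  have -> : \sum_(S : {set 'I_n}) \sum_(T : {set 'I_n})
      (n%:R^-1) ^+ 2 * ((n%:R^-1) ^+ #|S| * (n%:R^-1) ^+ #|T|) =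
      (n%:R^-1) ^+ 2 * ((1 + n%:R^-1) ^+ n * (1 + n%:R^-1) ^+ n) :> R.
    rewrite -sum_expr_card big_distrlr mulr_sumr; apply: eq_bigr => S _.
    by rewrite mulr_sumr.
  have le4 : (1 + n%:R^-1) ^+ n <= 4 :> R.
    apply: le_trans expR1_le4; have -> : (1 : R) = n%:R^-1 * n%:R.
      by rewrite mulVf ?gt_eqF.
    rewrite expRM_natr mulVf ?gt_eqF //.
    by rewrite lerXn2r ?nnegrE ?expR_ge0 ?expR_ge1Dx // addr_ge0 ?invr_ge0.
  apply: (@le_trans _ _ ((n%:R^-1) ^+ 2 * (4 * 4))).
    rewrite ler_wpM2l ?exprn_ge0 ?invr_ge0 // ler_pM // exprn_ge0 //
      addr_ge0 ?invr_ge0 //.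
  rewrite expr2 -mulrA mulrC ler_pM2r ?invr_gt0 //.
  by rewrite mulrC ler_pdivrMr //; move: n16; lra.
- apply: (@le_trans _ _ (\sum_(S : {set 'I_n}) \sum_(T : {set 'I_n})
      2 * expR (- (4 * n%:R)))).
    rewrite gnp_mean_sum; apply: ler_sum => S _.
    rewrite gnp_mean_sum; apply: ler_sum => T _.
    rewrite gnp_meanD [leRHS]mulr_natl mulr2n.
    by apply: lerD; exact: mean_edge_tail.
  rewrite !sumr_const; have -> : #|{set 'I_n}| = (2 ^ n)%N.
    by rewrite -cardsT -powersetT card_powerset cardsT card_ord.
  rewrite -[X in X *+ _]mulr_natr -[leLHS]mulr_natr natrX.
  have pow_le : 2 ^+ n <= expR (n%:R : R).
    rewrite -[n%:R]mul1r expRM_natr lerXn2r ?nnegrE ?expR_ge0 //.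
    by apply: le_trans (expR_ge1Dx 1); lra.
  apply: (@le_trans _ _ (2 * expR (- (2 * n%:R)))).
    have -> : expR (- (2 * n%:R)) =
        expR (- (4 * n%:R)) * expR (n%:R) * expR (n%:R) :> R.
      by rewrite -!expRD; congr expR; ring.
    rewrite !mulrA ler_pM ?mulr_ge0 ?expR_ge0 ?exprn_ge0 //.
    by rewrite ler_wpM2l ?mulr_ge0 ?expR_ge0.
  rewrite expRN ler_pdivrMr ?expR_gt0 //.
  apply: (@le_trans _ _ (1 / n%:R * (1 + 2 * n%:R))).
    by rewrite mulrDr mulrCA mul1r mulVf ?gt_eqF // mulr1 mulr1 lerDr invr_ge0.
  by rewrite ler_wpM2l ?expR_ge1Dx ?divr_ge0.
apply: (@le_trans _ _ (\sum_(v : 'I_n) 2 * expR (- (2 * l)))).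
  rewrite gnp_mean_sum; apply: ler_sum => v _; 
  rewrite gnp_meanD [leRHS]mulr_natl mulr2n.
  by apply: lerD; exact: mean_edge_tail.
have -> : expR (- (2 * l)) = n%:R^-1 * n%:R^-1.
  by rewrite -expRNl -expRD; congr expR; ring.
by rewrite sumr_const card_ord -[leLHS]mulr_natr !mulrA divfK ?gt_eqF.
Qed.

Lemma pseudorandom_of_deviation G : deviation G < 1 ->
  pseudorandom G p ((2 * l + 9) / Num.sqrt d) (8 * l).
Proof.
set q := Num.sqrt d; have q0 : 0 < q by apply: lt_le_trans d_large.
have d0 : 0 < d by rewrite -sqrtr_gt0.
have qq : q * q = d by rewrite -expr2 sqr_sqrtr // ltW.
have tail0 t y S T : 0 <= edge_tail t y S T G by rewrite expR_ge0.
rewrite /deviation; set E1 := (X in X + _ + _); set E2 := (X in _ + X + _).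
set E3 := (X in _ + X) => dev.
have E10 : 0 <= E1 by apply: sumr_ge0 => S _; exact: sumr_ge0.
have E20 : 0 <= E2.
  by apply: sumr_ge0 => S _; apply: sumr_ge0 => T _; exact: addr_ge0.
have E30 : 0 <= E3 by apply: sumr_ge0 => v _; exact: addr_ge0.
have card_le (S : {set 'I_n}) : #|S|%:R <= n%:R :> R.
  by rewrite ler_nat -[leqRHS]card_ord max_card.
have thq : th ^+ 2 * d = 1 by rewrite /th -/q -qq; field; rewrite gt_eqF.
have two_sided y S T : edge_tail th y S T G < 1 -> edge_tail (- th) y S T G < 1 ->
    `|(edge_count G S T)%:R - mean_edges S T| <=
      q * (4 * th ^+ 2 * (p * #|S|%:R * #|T|%:R) + y).
  move=> /edge_tail_lt1 up /edge_tail_lt1; rewrite sqrrN => lo.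
  have expand x : x = q * (th * x) by rewrite mulrA divff ?mul1r ?gt_eqF.
  rewrite [X in `|X|]expand normrM gtr0_norm // ler_pM2l //.
  by rewrite ler_norml; move: up lo => *; apply/andP; split; lra.
have q_ge4 : 4 <= q := d_large.
have qn : d <= q * n%:R.
  rewrite -qq ler_pM2l //; apply: (@le_trans _ _ (q * q)).
    by rewrite ler_peMl ?ltW //; lra.
  by rewrite qq ler_piMl // ltW.
have etad : (2 * l + 9) / q * d = (2 * l + 9) * q.
  by rewrite -qq; field; rewrite gt_eqF.
have lq : 0 <= l * q by rewrite mulr_ge0 // ltW.
split.
- move=> v; rewrite etad.
  have le_E3 : edge_tail th (2 * l) [set v] [set: 'I_n] G +
      edge_tail (- th) (2 * l) [set v] [set: 'I_n] G <= E3.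
    by apply: (@ler_sum_term _ xpredT (fun v => edge_tail th (2 * l) [set v]
      [set: 'I_n] G + edge_tail (- th) (2 * l) [set v] [set: 'I_n] G)) => // w;
      exact: addr_ge0.
  have := tail0 th (2 * l) [set v]%SET [set: 'I_n].
  have := tail0 (- th) (2 * l) [set v]%SET [set: 'I_n] => H1 H2.
  have := @two_sided (2 * l) [set v]%SET [set: 'I_n].
  rewrite edge_count_setT; have := mean_edges_bounds [set v]%SET [set: 'I_n].
  set mu := mean_edges [set v]%SET [set: 'I_n].
  rewrite cards1 cardsT card_ord !mulr1 => /andP[lo up] H.
  have : `|(deg G v)%:R - mu| <= q * (4 * th ^+ 2 * d + 2 * l).
    by apply: H; move: le_E3 H1 H2 dev E10 E20; lra.
  rewrite -[4 * _ * d]mulrA thq !ler_norml => /andP[H3 H4].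
  by move: p_le1 q_ge4 lq H3 H4 lo up => *; apply/andP; split; lra.
- move=> S T; rewrite etad.
  have le_E2 :
      edge_tail th (4 * n%:R) S T G + edge_tail (- th) (4 * n%:R) S T G <= E2.
    apply: le_trans (_ : \sum_(T : {set 'I_n}) (edge_tail th (4 * n%:R) S T G +
      edge_tail (- th) (4 * n%:R) S T G) <= _).
      by apply: (@ler_sum_term _ xpredT (fun T => edge_tail th (4 * n%:R) S T G +
        edge_tail (- th) (4 * n%:R) S T G)) => // T'; exact: addr_ge0.
    apply: (@ler_sum_term _ xpredT (fun S => \sum_(T : {set 'I_n})
      (edge_tail th (4 * n%:R) S T G + edge_tail (- th) (4 * n%:R) S T G))) => // S'.
    by apply: sumr_ge0 => T' _; exact: addr_ge0.
  have := tail0 th (4 * n%:R) S T; have := tail0 (- th) (4 * n%:R) S T => H1 H2.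
  have := @two_sided (4 * n%:R) S T; have := mean_edges_bounds S T.
  set mu := mean_edges S T => /andP[lo up] H.
  have : `|(edge_count G S T)%:R - mu| <=
      q * (4 * th ^+ 2 * (p * #|S|%:R * #|T|%:R) + 4 * n%:R).
    by apply: H; move: le_E2 H1 H2 dev E10 E30; lra.
  have le_n : th ^+ 2 * (p * #|S|%:R * #|T|%:R) <= n%:R.
    apply: (@le_trans _ _ (th ^+ 2 * (d * n%:R))).
      by rewrite ler_wpM2l ?sqr_ge0 // ler_pM ?mulr_ge0 // ler_wpM2l.
    by rewrite mulrA thq mul1r.
  have pS : p * #|S|%:R <= d by rewrite ler_wpM2l.
  have : q * (th ^+ 2 * (p * #|S|%:R * #|T|%:R)) <= q * n%:R by rewrite ler_pM2l.
  have lqn : 0 <= l * q * n%:R by rewrite mulr_ge0 // ltW.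
  rewrite !ler_norml => H5 /andP[H3 H4].
  by move: qn lo up pS H3 H4 H5 lqn => *; apply/andP; split; lra.
move=> S T.
have [->|S0] := eqVneq S finset.set0.
  rewrite /edge_count big_set0 !cards0 mulr0 mul0r !add0r.
  by rewrite mulr_ge0 // mulr_ge0.
have [->|T0] := eqVneq T finset.set0.
  rewrite /edge_count big1 => [|v _]; last by rewrite big_set0.
  by rewrite cards0 mulr0 add0r addr0 mulr_ge0 // mulr_ge0.
rewrite -card_gt0 in S0; rewrite -card_gt0 in T0.
have le_E1 : edge_tail (1 / 4) (2 * l * (#|S|%:R + #|T|%:R)) S T G <= E1.
  apply: le_trans (_ : \sum_(T : {set 'I_n} | (0 < #|T|)%N)
    edge_tail (1 / 4) (2 * l * (#|S|%:R + #|T|%:R)) S T G <= _).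
    by apply: (@ler_sum_term _ (fun T : {set 'I_n} => (0 < #|T|)%N) (fun T =>
      edge_tail (1 / 4) (2 * l * (#|S|%:R + #|T|%:R)) S T G)).
  apply: (@ler_sum_term _ (fun S : {set 'I_n} => (0 < #|S|)%N) (fun S =>
    \sum_(T : {set 'I_n} | (0 < #|T|)%N)
    edge_tail (1 / 4) (2 * l * (#|S|%:R + #|T|%:R)) S T G)) => // S'.
  exact: sumr_ge0.
have /edge_tail_lt1 : edge_tail (1 / 4) (2 * l * (#|S|%:R + #|T|%:R)) S T G < 1.
  by move: le_E1 dev E20 E30; lra.
have /andP[_] := mean_edges_bounds S T; set mu := mean_edges S T.
by lra.
Qed.

Lemma gnp_pseudorandom (A : pred (sgraph n)) :
  (forall G, pseudorandom G p ((2 * l + 9) / Num.sqrt d) (8 * l) -> A G) ->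
  1 - 4 / n%:R <= gnp_prob p A.
Proof.
move=> PA; apply: (@le_trans _ _ (1 - gnp_mean deviation)).
  by rewrite lerD2l lerN2 mean_deviation.
apply: gnp_prob_ge => G.
  rewrite /deviation !addr_ge0 //; apply: sumr_ge0 => S _;
    rewrite ?addr_ge0 ?expR_ge0 //.
    by apply: sumr_ge0 => T _; rewrite expR_ge0.
  by apply: sumr_ge0 => T _; rewrite addr_ge0 ?expR_ge0.
by apply: contraR; rewrite -ltNge => /pseudorandom_of_deviation /PA.
Qed.

End RandomGraph.

Section Asymptotics.
Context (R : realType).

Lemma cube_le_expR (x : R) : 0 <= x -> x ^+ 3 / 6 <= expR x.
Proof.
move=> x0; apply: le_trans (expR_ge1Dxn 2 x0); rewrite !factS fact0.
by rewrite lerDr.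
Qed.

Lemma three_le_expR : 3 <= expR (5 / 4 : R).
Proof.
have -> : 5 / 4 = 1 / 8 * 10%:R :> R by field.
rewrite expRM_natr; apply: (@le_trans _ _ ((1 + 1 / 8) ^+ 10)); last first.
  by rewrite lerXn2r ?nnegrE ?expR_ge0 ?expR_ge1Dx.
by rewrite -[3]/(3%:R) !exprS expr0; lra.
Qed.

(* With x = sqrt (ln n) and k close to 2x/3, the k-th power of d / (40 x^2),
   where d >= exp (2x), exceeds n, while 3 ^ k stays below sqrt d >= exp x. *)
Lemma growth_rate (K x d : R) : 1 <= K -> 100 * 100 * 100 * K <= x ->
  expR (2 * x) <= d -> exists k : nat,
  [/\ expR (x ^+ 2) <= (d / (5 * (8 * x ^+ 2))) ^+ k,
      K * (3 ^+ k * ((2 * x ^+ 2 + 9) / Num.sqrt d)) <= 1 &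
      expR x <= Num.sqrt d].
Proof.
move=> K1 xK dx.
have x_ge : 100 * 100 * 100 <= x by lra.
have x0 : 0 <= x by apply: le_trans x_ge; rewrite !mulr_ge0.
have x1 : 0 < x by apply: lt_le_trans x_ge; rewrite !mulr_gt0.
have d0 : 0 < d by apply: lt_le_trans dx; exact: expR_gt0.
have sq : expR x <= Num.sqrt d.
  rewrite -[leLHS](ger0_norm (expR_ge0 x)) -sqrtr_sqr; apply: ler_wsqrtr.
  by rewrite expr2 -expRD; apply: le_trans dx; rewrite ler_expR; lra.
pose k := (Num.truncn (2 * x / 3)).+1.
have /andP[k_le k_gt] : (Num.truncn (2 * x / 3))%:R <= 2 * x / 3 < k%:R.
  by apply: truncn_itv; lra.
exists k; split=> //.
  have base : expR (3 / 2 * x) <= d / (5 * (8 * x ^+ 2)).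
    rewrite ler_pdivlMr ?mulr_gt0 ?exprn_gt0 //.
    apply: le_trans dx; have -> : 2 * x = 3 / 2 * x + x / 2 by field.
    rewrite expRD ler_wpM2l ?expR_ge0 //.
    apply: le_trans (cube_le_expR _); last by lra.
    have : 100 * 100 * 100 * x ^+ 2 <= x * x ^+ 2 by rewrite ler_wpM2r ?exprn_ge0.
    by move: (exprn_ge0 2 x0); clear; lra.
  apply: le_trans (_ : expR (3 / 2 * x) ^+ k <= _); last first.
    by rewrite lerXn2r ?nnegrE ?(le_trans (expR_ge0 _) base) ?expR_ge0.
  rewrite -expRM_natr ler_expR.
  have : x * (2 * x / 3) <= x * k%:R by rewrite ler_wpM2l // ltW.
  by lra.
have pow3 : 3 ^+ k <= expR (5 / 4 + 5 / 6 * x).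
  apply: (@le_trans _ _ (expR (5 / 4) ^+ k)).
    by rewrite lerXn2r ?nnegrE ?expR_ge0 // three_le_expR.
  rewrite -expRM_natr ler_expR.
  by have : k%:R <= 2 * x / 3 + 1 by [rewrite -(natr1 (Num.truncn _)) lerD2r]; lra.
have q0 : 0 < Num.sqrt d by rewrite sqrtr_gt0.
rewrite [3 ^+ k * _]mulrA [K * _]mulrA ler_pdivrMr // mul1r.
apply: le_trans sq.
have -> : expR x = expR (5 / 6 * x) * expR (x / 6).
  by rewrite -expRD; congr expR; field.
have e54 : expR (5 / 4 : R) <= 16.
  apply: (@le_trans _ _ (expR (1 + 1))); first by rewrite ler_expR; lra.
  rewrite expRD; apply: (@le_trans _ _ (4 * 4)); last by lra.
  by rewrite ler_pM ?expR_ge0 ?expR1_le4.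
have x2 : 0 < x ^+ 2 by rewrite exprn_gt0.
have le_cube : K * (16 * (2 * x ^+ 2 + 9)) <= expR (x / 6).
  apply: le_trans (cube_le_expR _); last by lra.
  have x_ge1 : 1 <= x by apply: le_trans x_ge; clear; lra.
  have K0 : 0 <= K by apply: le_trans K1.
  have le1 : 2 * x ^+ 2 + 9 <= 11 * x ^+ 2.
    by move: (exprn_ege1 2 x_ge1); clear; lra.
  have le2 : K * (16 * (2 * x ^+ 2 + 9)) <= K * (16 * (11 * x ^+ 2)).
    by rewrite ler_wpM2l ?ler_pM2l.
  have le3 : 100 * 100 * 100 * K * x ^+ 2 <= x * x ^+ 2 by rewrite ler_pM2r.
  have Kx : 0 <= K * x ^+ 2 := mulr_ge0 K0 (ltW x2).
  by move: le2 le3 Kx; clear; lra.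
have e0 := expR_gt0 (5 / 6 * x).
rewrite expRD in pow3.
have : K * (3 ^+ k * (2 * x ^+ 2 + 9)) <=
    K * (16 * expR (5 / 6 * x) * (2 * x ^+ 2 + 9)).
  apply: ler_wpM2l; first exact: le_trans K1.
  apply: ler_wpM2r.
    by apply: addr_ge0 => //; apply: mulr_ge0 => //; exact: ltW.
  by apply: le_trans pow3 _; rewrite ler_pM2r.
move/le_trans; apply.
have -> : K * (16 * expR (5 / 6 * x) * (2 * x ^+ 2 + 9)) =
   expR (5 / 6 * x) * (K * (16 * (2 * x ^+ 2 + 9))) by ring.
by rewrite ler_pM2l.
Qed.

End Asymptotics.

Lemma gnp_toppling_number (R : realType) (e : R) : 0 < e -> e <= 1 ->
  exists n0 : R, forall (n : nat) (p : R), n0 <= n%:R -> 0 <= p <= 1 ->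
    n%:R `^ (2 / Num.sqrt (ln n%:R)) <= p * n%:R ->
    1 - 4 / n%:R <= gnp_prob p (fun G : sgraph n =>
      `| toppling_number R G - p * toppling_number R (complete_graph n) |
        <= e * (p * toppling_number R (complete_graph n))).
Proof.
move=> e0 e1.
pose N := (Num.truncn (192 / e)).+1.
have /andP[_ N_gt] : (Num.truncn (192 / e))%:R <= 192 / e < N%:R.
  by apply: truncn_itv; apply: divr_ge0 (ler0n _ _) (ltW e0).
have N0 : 0 < N%:R :> R by rewrite ltr0n.
pose C : R := ((2 * (3 * N)).+2 * 12).+1%:R * (100 * (3 * N + 4)%:R).
have C0 : 0 <= C by rewrite !mulr_ge0.
pose K1 := C * (128 / e) ^+ 2; pose K2 := 10 * (128 * (N%:R + 1)) / e.
have K10 : 0 <= K1 by apply: mulr_ge0 C0 (sqr_ge0 _).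
have K20 : 0 <= K2.
  apply: divr_ge0 (ltW e0); apply: mulr_ge0 (ler0n _ _) _.
  by apply: mulr_ge0 (ler0n _ _) _; apply: addr_ge0.
pose K := K1 + K2 + 100; pose x0 := 100 * 100 * 100 * K.
have KE : K = K1 + K2 + 100 by [].
have x0E : x0 = 100 * 100 * 100 * K by [].
have CE : C = ((2 * (3 * N)).+2 * 12).+1%:R * (100 * (3 * N + 4)%:R) by [].
have K1E : K1 = C * (128 / e) ^+ 2 by [].
have K2E : K2 = 10 * (128 * (N%:R + 1)) / e by [].
clearbody x0 K K1 K2 C N; have x00 : 100 * 100 * 100 <= x0 by lra.
exists (expR (x0 ^+ 2)) => n p n_ge /andP[p0 p1] dn.
set d := p * n%:R in dn *; set x := Num.sqrt (ln n%:R) in dn.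
have n0 : 0 < n%:R :> R by apply: lt_le_trans n_ge; exact: expR_gt0.
have ln_ge : x0 ^+ 2 <= ln n%:R by rewrite -ler_expR lnK.
have xE : x ^+ 2 = ln n%:R.
  by rewrite sqr_sqrtr //; apply: le_trans ln_ge; exact: sqr_ge0.
have x_ge : x0 <= x.
  rewrite -[x0]ger0_norm -?sqrtr_sqr ?ler_wsqrtr //.
  by apply: le_trans x00; clear; lra.
have x_million : 100 * 100 * 100 <= x := le_trans x00 x_ge.
have x_gt0 : 0 < x by move: x_million; clear; lra.
have {}dn : expR (2 * x) <= d.
  have -> : expR (2 * x) = n%:R `^ (2 / x).
    by rewrite /powR gt_eqF // -xE; congr expR; field; rewrite gt_eqF.
  by [].
have d2x : 2 * x <= d.
  by apply: le_trans dn; apply: le_trans (expR_ge1Dx _); rewrite lerDr.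
have [k [nk K3k sqd]] : exists k : nat,
  [/\ expR (x ^+ 2) <= (d / (5 * (8 * x ^+ 2))) ^+ k,
      K * (3 ^+ k * ((2 * x ^+ 2 + 9) / Num.sqrt d)) <= 1 &
      expR x <= Num.sqrt d].
  apply: growth_rate => //; last by rewrite -x0E.
  by rewrite KE; move: K10 K20; clear; lra.
rewrite xE lnK // in nk; rewrite xE in K3k.
have sq4 : 4 <= Num.sqrt d.
  apply: le_trans sqd; apply: le_trans (expR_ge1Dx x).
  by move: x_million; clear; lra.
have p_gt0 : 0 < p.
  rewrite lt_neqAle p0 andbT; apply/eqP => p0'.
  by move: d2x x_gt0; rewrite /d -p0' mul0r; clear; lra.
have n16 : (16 <= n)%N.
  rewrite -(ler_nat R); apply: le_trans n_ge; apply: le_trans (expR_ge1Dx _).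
  have x01 : 1 <= x0 by apply: le_trans x00; clear; lra.
  have : 100 * 100 * 100 * 1 <= x0 * x0 by rewrite ler_pM // !mulr_ge0.
  by rewrite expr2; clear; lra.
apply: gnp_pseudorandom => // G prG.
set eta := (2 * ln n%:R + 9) / Num.sqrt d in prG K3k.
have ln0 : 0 < ln n%:R :> R by rewrite -xE exprn_gt0.
have eta0 : 0 <= eta by rewrite divr_ge0 ?sqrtr_ge0 // addr_ge0 // mulr_ge0 // ltW.
have pow1 : 1 <= 3 ^+ k :> R by rewrite exprn_ege1 // ler1n.
set y := 3 ^+ k * eta in K3k.
have y0 : 0 <= y by rewrite mulr_ge0 // exprn_ge0.
have Ky : K1 * y + 100 * y <= 1.
  have := mulr_ge0 K20 y0; move: K3k; rewrite KE; clear; lra.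
apply: (toppling_pseudorandom prG (N := N) (k := k)) => //.
- exact: leq_trans n16.
- have : eta <= y by rewrite /y ler_peMl.
  by have := mulr_ge0 K10 y0; move: Ky; clear; lra.
- by rewrite mulr_gt0.
- by rewrite -(ltr_nat R).
- have spread_le :
      (spread (3 * N) k)%:R <= ((2 * (3 * N)).+2 * 12).+1%:R * 3 ^+ k :> R.
    rewrite -natrX -natrM ler_nat /spread [leqRHS]mulSn mulnA.
    by rewrite -[X in (X <= _)%N]add1n leq_add2r expn_gt0.
  apply: (@le_trans _ _ (C * y)).
    have -> : C * y =
        ((2 * (3 * N)).+2 * 12).+1%:R * 3 ^+ k * eta * (100 * (3 * N + 4)%:R).
      by rewrite CE /y; ring.
    by rewrite ler_wpM2r ?mulr_ge0 // ler_wpM2r.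
  have -> : C * y = (e / 128) ^+ 2 * (K1 * y).
    by rewrite K1E; field; rewrite gt_eqF.
  by rewrite ler_piMr ?sqr_ge0 //; move: Ky y0; clear; lra.
- by rewrite ler_pdivrMr // mulrC -ler_pdivrMr // ltW.
have : K2 <= d.
  apply: le_trans d2x; move: x_ge K10 K20; rewrite x0E KE; clear; lra.
by rewrite K2E ler_pdivrMr // [d * e]mulrC.
Qed.

Local Open Scope classical_set_scope.

Theorem theorem1p2 (R : realType) (p : nat -> R)
  (p01 : forall n : nat, 0 <= p n <= 1)
  (hp : \forall n \near \oo,
          (n%:R : R) `^ (2 / Num.sqrt (ln (n%:R : R))) <= p n * n%:R)
  (eps : R) (eps_gt0 : 0 < eps) :
  aas p (fun (n : nat) (G : sgraph n) =>
    `| toppling_number R G - p n * toppling_number R (complete_graph n) |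
      <= eps * (p n * toppling_number R (complete_graph n))).
Proof.
pose e := Num.min eps 1.
have e0 : 0 < e by rewrite lt_min eps_gt0 ltr01.
have [|n0 Hn0] := gnp_toppling_number e0; first by rewrite ge_min lexx orbT.
apply/cvgrPdist_le => r r0; near=> n.
have n_ge : n0 <= n%:R by near: n; exact: nbhs_infty_ger.
have n_r : 4 / r <= n%:R by near: n; exact: nbhs_infty_ger.
have n8 : (8 <= n)%N by near: n; exact: nbhs_infty_ge.
have n_gt0 : 0 < n%:R :> R by rewrite ltr0n; apply: leq_trans n8.
have hpn : (n%:R : R) `^ (2 / Num.sqrt (ln (n%:R : R))) <= p n * n%:R by near: n.
have /andP[pn0 pn1] := p01 n.
rewrite ger0_norm ?subr_ge0 ?gnp_prob_le1 //.
apply: (@le_trans _ _ (4 / n%:R)); last first.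
  by rewrite ler_pdivrMr // mulrC -ler_pdivrMr.
rewrite lerBlDr -lerBlDl.
apply: le_trans (Hn0 n (p n) n_ge (p01 n) hpn) _.
apply: le_gnp_prob => // G /le_trans; apply.
rewrite ler_wpM2r ?ge_min ?lexx // mulr_ge0 //.
by apply: le_trans (toppling_complete_ge R n8); rewrite divr_ge0 // mulr_ge0.
Unshelve. all: by end_near.
Qed.
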